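(* Assume (A1) and (A2). Moreover, let $\sigma$ be a Lipschitz function on $\mathbb R^n$, and let $u(t,x)=\max_{q\in\mathbb R^n}\{\langle x,q\rangle-\sigma^*(q)-\int_0^tH(\tau,q)\,d\tau\}$. For each $\epsilon>0$ there exists $\delta>0$ such that if $(t_0,x_0)\in\Omega$ is a singular point for $u$, then for any $t_1\in[t_0,t_0+\delta]$ with $t_1<T$ there exists $x_1\in B'(x_0,\epsilon)$ such that $(t_1,x_1)$ is also a singular point for $u$.
   Context: Let $T>0$ and $\Omega=(0,T)\times\mathbb R^n$. Let $H=H(t,p)$ be a real-valued function of class $C^1$ on $[0,T]\times\mathbb R^n$ and $\sigma:\mathbb R^n\to\mathbb R$ be convex and of class $C^1$. $\sigma^*:\mathbb R^n\to\mathbb R\cup\{+\infty\}$ is the Fenchel conjugate of $\sigma$. $B'(x_0,r)$ is the closed ball centered at $x_0$ with radius $r$. Condition (A1): for every $(t_0,x_0)\in[0,T)\times\mathbb R^n$ there exist positive constants $r$ and $N$ such that $$\langle x,p\rangle-\sigma^*(p)-\int_0^tH(\tau,p)\,d\tau<\max_{|q|\le N}\Big\{\langle x,q\rangle-\sigma^*(q)-\int_0^tH(\tau,q)\,d\tau\Big\}$$ whenever $(t,x)\in[0,T)\times\mathbb R^n$, $|t-t_0|+|x-x_0|<r$ and $|p|>N$. Condition (A2): $H$ has one of the two following forms: a) $H(t,\cdot)$ is convex for all $t\in(0,T)$, or $H(t,\cdot)$ is concave for all $t\in(0,T)$; b) $H(t,p)=g(t)h(p)+k(t)$ for some functions $g,h,k$,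 where $g(t)$ does not change its sign on $(0,T)$. A point $(t,x)\in\Omega$ is singular for $u$ if $u$ is not differentiable (jointly in $(t,x)$) at this point. *)

(* Defs.v *)
From mathcomp Require Import all_boot all_order all_algebra.
From mathcomp Require Import all_classical all_reals all_analysis.
Import Order.TTheory GRing.Theory Num.Theory.
Import numFieldNormedType.Exports.

Set Implicit Arguments.
Unset Strict Implicit.
Unset Printing Implicit Defensive.

Local Open Scope classical_set_scope.
Local Open Scope ring_scope.

(* The library norm `|x| on 'rV[R]_n is the sup norm, hence a separate
   Euclidean norm. *)
Definition dot (R : realType) (n : nat) (x y : 'rV[R]_n) : R :=
  \sum_(i < n) x 0 i * y 0 i.

Definition enorm (R : realType) (n : nat) (x : 'rV[R]_n) : R :=
  Num.sqrt (dot x x).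

(* f is of class C^1 on a set A which need not be open: f has at each z in A a
   differential relative to A, and the differentials can be chosen to depend
   continuously on z in A. This is meant for a finite-dimensional E, where
   continuity of z |-> df z v for each v is continuity of df in operator norm,
   and for A contained in the closure of its interior, where df is unique (on
   [0, T] x R^n it is one-sided in time at the two end times). *)
Definition C1_on (R : realType) (E : normedModType R) (A : set E)
    (f : E -> R) : Prop :=
  exists df : E -> {linear E -> R},
    (forall z, A z -> forall eps : R, 0 < eps ->
       \forall w \near within A (nbhs z),
         `|f w - f z - df z (w - z)| <= eps * `|w - z|) /\
    (forall v : E, {within A, continuous (fun z => df z v)}).

(* The greatest element of S; by convention -oo if S has none. *)
Definition emax (R : realType) (S : set (\bar R)) : \bar R :=
  xget -oo%E [set m | S m /\ ubound S m].

Definition fenchel (R : realType) (n : nat) (sigma : 'rV[R]_n -> R)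
    (p : 'rV[R]_n) : \bar R :=
  ereal_sup (range (fun x => (dot x p - sigma x)%:E)).

(* <x, q> - sigma^*(q) - \int_0^t H(tau, q) dtau, with value -oo when
   sigma^*(q) = +oo. *)
Definition hopf_arg (R : realType) (n : nat) (H : R -> 'rV[R]_n -> R)
    (sigma : 'rV[R]_n -> R) (t : R) (x q : 'rV[R]_n) : \bar R :=
  ((dot x q)%:E - fenchel sigma q
   - (\int[lebesgue_measure]_(tau in `[0%R, t]) H tau q)%R%:E)%E.

Definition hopf (R : realType) (n : nat) (H : R -> 'rV[R]_n -> R)
    (sigma : 'rV[R]_n -> R) (z : R * 'rV[R]_n) : R :=
  fine (emax (range (hopf_arg H sigma z.1 z.2))).

Definition A1 (R : realType) (n : nat) (T : R) (H : R -> 'rV[R]_n -> R)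
    (sigma : 'rV[R]_n -> R) : Prop :=
  forall (t0 : R) (x0 : 'rV[R]_n), 0 <= t0 < T ->
  exists r N : R, [/\ 0 < r, 0 < N &
    forall (t : R) (x p : 'rV[R]_n), 0 <= t < T ->
      `|t - t0| + enorm (x - x0) < r -> N < enorm p ->
      (hopf_arg H sigma t x p <
       emax [set hopf_arg H sigma t x q | q in [set q | (enorm q <= N)%R]])%E].

Definition A2 (R : realType) (n : nat) (T : R) (H : R -> 'rV[R]_n -> R) : Prop :=
  ((forall t, 0 < t < T -> convex_function setT (H t)) \/
   (forall t, 0 < t < T -> convex_function setT (fun p => - H t p))) \/
  (exists (g : R -> R) (h : 'rV[R]_n -> R) (k : R -> R),
     (forall t p, 0 <= t <= T -> H t p = g t * h p + k t) /\
     ((forall t, 0 < t < T -> 0 <= g t) \/ (forall t, 0 < t < T -> g t <= 0))).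

Definition singular (R : realType) (n : nat) (T : R) (u : R * 'rV[R]_n -> R)
    (z : R * 'rV[R]_n) : Prop :=
  0 < z.1 < T /\ ~ differentiable u z.

(* Main.v *)
From HB Require Import structures.
Require Import Defs.
From mathcomp Require Import all_boot all_order all_algebra.
From mathcomp Require Import all_classical all_reals all_analysis.
From mathcomp Require Import ring lra.
Import Order.TTheory GRing.Theory Num.Theory.
Import numFieldNormedType.Exports.
Local Open Scope classical_set_scope.
Local Open Scope ring_scope.

(* Write A(t, q) for the integral of H(., q) over [0, t], and E for the epigraph
   of sigma^*, so that u(t, x) is the maximum over (q, r) in E of
   <x, q> - r - A(t, q). By compactness u is differentiable at every point
   where the maximizer is unique; conversely, where u(t, .) is differentiable
   its gradient is the only maximizer.

   Suppose u(t1, .) is differentiable on the ball of radius eps about x0. If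
   A(t0, .) is convex, the maximizer at (t0, x0) is unique because sigma is
   differentiable. Otherwise (A2) makes A(t1, .) - A(t0, .) concave or gives
   A(t0, .) = theta A(t1, .) + c with 0 < theta < 1. In both cases the
   objective at (t0, x0) is, for each x, bounded by theta times the objective
   at (t1, x) plus psi(x), for a suitable convex psi (with theta = 1 in the
   concave case). Minimizing theta u(t1, .) + psi over the ball yields a point
   x1 of the ball whose maximizer q at (t1, x1) makes this bound an equality:
   the first-order condition at the minimum is compared with the point reached
   by following the characteristic of slope q back to time t0, which cannot
   leave the ball when t1 - t0 is small. This replaces a Brouwer fixed point
   of the characteristic map. Equality forces every maximizer at (t0, x0) to
   be a maximizer at (t1, x1), hence to be q. *)

(** * Bilinearity and positivity of the Euclidean inner product *)

Section DotProduct.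
Context {R : realType} {n : nat}.
Implicit Types (x y z : 'rV[R]_n) (a : R).

Lemma dotC x y : dot x y = dot y x.
Proof. by apply: eq_bigr => i _; rewrite mulrC. Qed.

Lemma dotDl x y z : dot (x + y) z = dot x z + dot y z.
Proof. by rewrite /dot -big_split/=; apply: eq_bigr => i _; rewrite mxE mulrDl. Qed.

Lemma dotZl a x y : dot (a *: x) y = a * dot x y.
Proof. by rewrite /dot big_distrr/=; apply: eq_bigr => i _; rewrite mxE mulrA. Qed.

Lemma dotDr x y z : dot x (y + z) = dot x y + dot x z.
Proof. by rewrite dotC dotDl !(dotC _ x). Qed.

Lemma dotZr a x y : dot x (a *: y) = a * dot x y.
Proof. by rewrite dotC dotZl dotC. Qed.

Lemma dotNl x y : dot (- x) y = - dot x y.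
Proof. by rewrite -scaleN1r dotZl mulN1r. Qed.

Lemma dotNr x y : dot x (- y) = - dot x y.
Proof. by rewrite dotC dotNl dotC. Qed.

Lemma dot0l y : dot 0 y = 0.
Proof. by rewrite -(scale0r 0) dotZl mul0r. Qed.

Lemma dot0r y : dot y 0 = 0.
Proof. by rewrite dotC dot0l. Qed.

Definition dotE := (dotDl, dotDr, dotNl, dotNr, dotZl, dotZr, dot0l, dot0r).

Lemma dotxx_ge0 x : 0 <= dot x x.
Proof. by apply: sumr_ge0 => i _; rewrite -expr2 sqr_ge0. Qed.

Lemma dotxx_eq0 x : dot x x = 0 -> x = 0.
Proof.
move/eqP; rewrite psumr_eq0 => [/allP h|i _]; last by rewrite -expr2 sqr_ge0.
apply/rowP => i; have := h i (mem_index_enum _).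
by rewrite mulf_eq0 orbb mxE => /eqP.
Qed.

Lemma dot_linear (f : {linear 'rV[R]_n -> R}) x :
  f x = dot x (\row_i f (delta_mx 0 i)).
Proof.
rewrite {1}(row_sum_delta x) linear_sum; apply: eq_bigr => i _.
by rewrite linearZ mxE.
Qed.

End DotProduct.

(** * One-sided directional gradients and first-order conditions *)

Section Gradient.
Context {R : realType} {n : nat}.
Implicit Types (x q a d : 'rV[R]_n) (f : 'rV[R]_n -> R).

(* Gateaux differentiability with one-sided directional derivatives: this is all
   that the first-order conditions below require. *)
Definition is_grad f x a := forall d (e : R), 0 < e ->
  exists2 s0, 0 < s0 & forall s, 0 < s < s0 ->
    `|f (x + s *: d) - f x - s * dot a d| <= s * e.

Lemma is_grad_dir_le f x a d (c : R) : is_grad f x a ->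
  (exists2 s0, 0 < s0 & forall s, 0 < s < s0 -> f (x + s *: d) - f x <= s * c) ->
  dot a d <= c.
Proof.
move=> fa [s1 s1_gt0 h1]; apply/ler_addgt0Pr => e e_gt0.
have [s0 s0_gt0 h0] := fa d e e_gt0.
pose s := Num.min s0 s1 / 2.
have m_gt0 : 0 < Num.min s0 s1 by rewrite lt_min s0_gt0.
have s_gt0 : 0 < s by rewrite /s; lra.
have sm : s < Num.min s0 s1 by rewrite /s; lra.
have /andP[ss0 ss1] : (s < s0) && (s < s1) by rewrite -lt_min.
have {}h0 := h0 s; have {}h1 := h1 s.
rewrite s_gt0 ss0 in h0; rewrite s_gt0 ss1 in h1.
have {}h0 := h0 isT; have {}h1 := h1 isT.
rewrite -(ler_pM2l s_gt0).
move: h0; rewrite ler_norml => /andP[h0 _]; nra.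
Qed.

Lemma is_grad_dir_ge f x a d (c : R) : is_grad f x a ->
  (exists2 s0, 0 < s0 & forall s, 0 < s < s0 -> s * c <= f (x + s *: d) - f x) ->
  c <= dot a d.
Proof.
move=> fa [s1 s1_gt0 h1]; rewrite -lerN2 -dotNl.
apply: (@is_grad_dir_le (fun x => - f x) x).
  move=> d' e e_gt0; have [s0 s0_gt0 h0] := fa d' e e_gt0.
  exists s0 => // s /h0; rewrite -normrN dotNl; congr (_ <= _).
  by congr `| _ |; ring.
by exists s1 => // s /h1; lra.
Qed.

(** Testing the subgradient inequality in the direction [q - a] gives [dot (q - a) (q - a) <= 0]. *)
Lemma is_grad_subgrad f x a q : is_grad f x a ->
  (forall z, f x + dot q (z - x) <= f z) -> q = a.
Proof.
move=> fa fq; apply/subr0_eq/dotxx_eq0; apply/le_anti.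
rewrite dotxx_ge0 andbT dotDl dotNl subr_le0.
apply: is_grad_dir_ge fa _; exists 1 => // s /andP[s_gt0 _].
by have := fq (x + s *: (q - a)); rewrite addrAC subrr add0r dotZr; lra.
Qed.

End Gradient.

(** * Maximizers over the epigraph of the conjugate *)

Section Epigraph.
Context {R : realType} {n : nat} {sigma : 'rV[R]_n -> R}.
Implicit Types (x y q a d : 'rV[R]_n) (w : 'rV[R]_n * R) (B : 'rV[R]_n -> R).

(* The epigraph of sigma^*. *)
Definition conj_epi (sigma : 'rV[R]_n -> R) : set ('rV[R]_n * R) :=
  [set w | forall x, dot x w.1 - sigma x <= w.2].

(** The objective of the Hopf formula with a height [w.2] in place of sigma^*(w.1); over the
    epigraph it is finite and has the same maximum. *)
Definition gain B x w := dot x w.1 - w.2 - B w.1.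

Definition is_maximizer B x w := conj_epi sigma w /\
  forall w', conj_epi sigma w' -> gain B x w' <= gain B x w.

Definition at_most_one_maximizer B x := forall w1 w2,
  is_maximizer B x w1 -> is_maximizer B x w2 -> w1 = w2.

Definition segment_point w w' (s : R) : 'rV[R]_n * R :=
  (w.1 + s *: (w'.1 - w.1), w.2 + s * (w'.2 - w.2)).

Lemma conj_epi_segment w w' (s : R) : 0 <= s <= 1 ->
  conj_epi sigma w -> conj_epi sigma w' ->
  conj_epi sigma (segment_point w w' s).
Proof.
move=> /andP[s0 s1] hw hw' x; have := hw x; have := hw' x.
rewrite /= !dotE; nra.
Qed.

(** Moving from [w] towards [w'] stays in the convex epigraph and cannot increase the gain; to first
    order [B] may be replaced by its linearization at [w.1]. *)
Lemma maximizer_conj_subgrad B x w a : is_grad B w.1 a -> is_maximizer B x w ->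
  forall w', conj_epi sigma w' -> dot (x - a) w'.1 - w'.2 <= dot (x - a) w.1 - w.2.
Proof.
move=> Ba [w_epi w_max] w' w'_epi.
suff : dot x (w'.1 - w.1) - (w'.2 - w.2) <= dot a (w'.1 - w.1).
  by rewrite !dotE; lra.
apply: is_grad_dir_ge Ba _; exists 1 => // s /andP[s0 s1].
have s01 : 0 <= s <= 1 by rewrite !ltW.
have := w_max _ (conj_epi_segment w w' s s01 w_epi w'_epi).
by rewrite /gain/= dotDr dotZr; lra.
Qed.

Hypothesis sigma_convex : forall x y (s : R), 0 <= s <= 1 ->
  sigma (x + s *: (y - x)) <= sigma x + s * (sigma y - sigma x).

Variable dsigma : 'rV[R]_n -> 'rV[R]_n.
Hypothesis dsigma_grad : forall x, is_grad sigma x (dsigma x).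

(** The tangent at [y] lies below the convex function [sigma], so the conjugate at the slope
    [dsigma y] is attained at [y]. *)
Lemma conj_epi_grad y : conj_epi sigma (dsigma y, dot y (dsigma y) - sigma y).
Proof.
move=> x /=.
suff : dot (dsigma y) (x - y) <= sigma x - sigma y.
  by rewrite dotC !dotE; lra.
apply: is_grad_dir_le (dsigma_grad y) _; exists 1 => // s /andP[s0 s1].
have s01 : 0 <= s <= 1 by rewrite !ltW.
by have := sigma_convex y x s s01; lra.
Qed.

(** Equality in Fenchel's inequality makes [w.1] a subgradient of [sigma] at [y], and
    differentiability leaves only one. *)
Lemma conj_epi_eq y w : conj_epi sigma w -> dot y w.1 - w.2 = sigma y ->
  w = (dsigma y, dot y (dsigma y) - sigma y).
Proof.
move=> w_epi wy; suff w1 : w.1 = dsigma y.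
  by rewrite [w]surjective_pairing -w1; congr (_, _); lra.
apply: is_grad_subgrad (dsigma_grad y) _ => z.
by have := w_epi z; rewrite (dotC w.1) !dotE; lra.
Qed.

(* First-order condition: the maximizer at [x] is the (sub)gradient of sigma
   at the foot [x - a] of the characteristic through [x]. *)
Lemma maximizer_foot B x w a : is_grad B w.1 a -> is_maximizer B x w ->
  dot (x - a) w.1 - w.2 = sigma (x - a).
Proof.
move=> Ba w_max; apply/le_anti/andP; split.
  by have := w_max.1 (x - a); lra.
have := maximizer_conj_subgrad _ _ _ _ Ba w_max _ (conj_epi_grad (x - a)).
by rewrite /=; lra.
Qed.

(** The midpoint of two maximizers is again one, so Fenchel's inequality is an equality there at the
    foot of its characteristic. It is then an equality for both endpoints at the same foot, which
    determines them. *)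
Lemma maximizer_unique_convex B (dB : 'rV[R]_n -> 'rV[R]_n) x :
  (forall q, is_grad B q (dB q)) ->
  (forall p q, B (p + 2^-1 *: (q - p)) <= B p + 2^-1 * (B q - B p)) ->
  at_most_one_maximizer B x.
Proof.
move=> B_grad B_cvx w1 w2 m1 m2.
have h2 : 0 <= (2^-1 : R) <= 1 by apply/andP; split; lra.
pose w := segment_point w1 w2 2^-1.
have w_epi : conj_epi sigma w by apply: conj_epi_segment h2 m1.1 m2.1.
have g12 := m1.2 _ m2.1; have g21 := m2.2 _ m1.1.
have gw : gain B x w1 <= gain B x w.
  move: g12 g21; rewrite /w /gain /= !dotE.
  have := B_cvx w1.1 w2.1; lra.
have m : is_maximizer B x w.
  by split=> // w' w'_epi; apply: le_trans gw; exact: m1.2.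
have foot := maximizer_foot _ _ _ _ (B_grad w.1) m.
move: (x - dB w.1) foot => y foot.
have e1 := m1.1 y; have e2 := m2.1 y.
move: (foot); rewrite /w /= !dotE => foot'.
rewrite (conj_epi_eq y w1 m1.1); last by lra.
by rewrite (conj_epi_eq y w2 m2.1)//; lra.
Qed.

End Epigraph.

(** * Comparison of norms, continuity and compactness for row vectors *)

Section RowVectorTopology.
Context {R : realType} {n : nat}.
Implicit Types (x y z : 'rV[R]_n).

Lemma coord_le_norm x i : `|x 0 i| <= `|x|.
Proof.
rewrite [leRHS]/Num.norm /= mx_normrE.
by apply/bigmax_geP; right; exists (0, i) => //=; rewrite mem_index_enum.
Qed.

Lemma sqr_norm_le_dot x : `|x| ^+ 2 <= dot x x.
Proof.
have [->|] := eqVneq `|x| 0; first by rewrite expr0n dotxx_ge0.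
move=> /mx_norm_neq0[[i j] /= xij]; rewrite [`|x|]xij.
rewrite (ord1 i) real_normK ?num_real// /dot (bigD1 j)//= -expr2 lerDl.
by apply: sumr_ge0 => k _; rewrite -expr2 sqr_ge0.
Qed.

Lemma norm_le_enorm x : `|x| <= enorm x.
Proof.
by rewrite -[leLHS]ger0_norm// -sqrtr_sqr ler_wsqrtr// sqr_norm_le_dot.
Qed.

Lemma norm_dot_le x y : `|dot x y| <= n%:R * `|x| * `|y|.
Proof.
rewrite -mulrA mulr_natl; have <- : \sum_(i < n) `|x| * `|y| = (`|x| * `|y|) *+ n.
  by rewrite sumr_const card_ord.
apply: le_trans (ler_norm_sum _ _ _) _; apply: ler_sum => i _.
by rewrite normrM ler_pM// coord_le_norm.
Qed.

Lemma enorm_le x (c : R) : (forall i, `|x 0 i| <= c) -> enorm x <= n%:R * c.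
Proof.
(* In dimension zero nothing forces [c] to be nonnegative, hence the separate case. *)
move=> xc; case: n x xc => [|m] x xc.
  by rewrite /enorm /dot big_ord0 sqrtr0 mul0r.
have c0 : 0 <= c by apply: le_trans (xc 0).
rewrite -[leRHS]ger0_norm ?mulr_ge0// -sqrtr_sqr ler_wsqrtr//.
apply: (@le_trans _ _ (m.+1%:R * c ^+ 2)).
  rewrite mulr_natl; have <- : \sum_(i < m.+1) c ^+ 2 = c ^+ 2 *+ m.+1.
    by rewrite sumr_const card_ord.
  apply: ler_sum => i _; rewrite -expr2 -real_normK ?num_real//.
  by rewrite ler_pXn2r ?nnegrE// xc.
by rewrite exprMn ler_wpM2r ?sqr_ge0// expr2 ler_peMr// ler1n.
Qed.

Lemma continuous_dot (T : topologicalType) (f g : T -> 'rV[R]_n) :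
  continuous f -> continuous g -> continuous (fun t => dot (f t) (g t)).
Proof.
move=> cf cg; rewrite /dot; elim: (index_enum _) => [|i s IH] t.
  by under eq_fun do rewrite big_nil; exact: cvg_cst.
under eq_fun do rewrite big_cons; apply: cvgD; last exact: IH.
have coord (h : T -> 'rV[R]_n) : continuous h ->
    {for t, continuous (fun u => h u 0 i)}.
  move=> ch; apply: (@continuous_comp _ _ _ h (fun x : 'rV[R]_n => x 0 i)).
    exact: ch.
  exact: coord_continuous.
by apply: cvgM; apply: coord.
Qed.

Lemma continuous_enorm (T : topologicalType) (f : T -> 'rV[R]_n) :
  continuous f -> continuous (fun t => enorm (f t)).
Proof.
move=> cf t; apply: (@continuous_comp _ _ _ (fun t => dot (f t) (f t)) Num.sqrt).
  by apply: continuous_dot.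
exact: sqrt_continuous.
Qed.

Lemma closed_le_fun (T : topologicalType) (f g : T -> R) :
  continuous f -> continuous g -> closed [set t | f t <= g t].
Proof.
move=> cf cg; have -> : [set t | f t <= g t] = (g \- f) @^-1` [set x | 0 <= x].
  by apply/seteqP; split => t /=; rewrite subr_ge0.
apply: preimage_closed; last exact: closed_ge.
by move=> t _; apply: continuousB; [exact: cg|exact: cf].
Qed.

Lemma compact_norm_ball (N : R) : compact [set q : 'rV[R]_n | `|q| <= N].
Proof.
apply: bounded_closed_compact.
  exists N; split; first exact: num_real.
  by move=> M NM q /= qN; exact: (le_trans qN (ltW NM)).
apply: (@closed_le_fun _ Num.norm (fun=> N)); first exact: norm_continuous.
exact: cst_continuous.
Qed.

Lemma compact_enorm_ball x (e : R) : compact [set z : 'rV[R]_n | enorm (z - x) <= e].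
Proof.
apply: bounded_closed_compact.
  exists (e + `|x|); split; first exact: num_real.
  move=> M eM z /= ze; rewrite -[z](subrK x); apply: le_trans (ler_normD _ _) _.
  by apply: le_trans (ltW eM); rewrite lerD2r (le_trans (norm_le_enorm _)).
apply: (@closed_le_fun _ (fun z => enorm (z - x)) (fun=> e)).
  apply: continuous_enorm => z.
  by apply: continuousB; [exact: cvg_id|exact: cst_continuous].
exact: cst_continuous.
Qed.

End RowVectorTopology.

(** * Bounded slopes and existence of maximizers for Lipschitz [sigma] *)

Section ConjugateEpigraph.
Context {R : realType} {n : nat} {sigma : 'rV[R]_n -> R} {L : R}.
Hypothesis L_ge0 : 0 <= L.
Hypothesis sigma_lip : forall x y, `|sigma x - sigma y| <= L * `|x - y|.
Implicit Types (x y q : 'rV[R]_n) (w : 'rV[R]_n * R) (B : 'rV[R]_n -> R).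

(** Along the ray of the points [s *: w.1] the function [sigma] grows at rate at most [L * |w.1|],
    whereas the inner product with [w.1] grows at rate at least [|w.1| ^+ 2]; a slope longer than
    [L] would leave no finite height. *)
Lemma conj_epi_norm_le w : conj_epi sigma w -> `|w.1| <= L.
Proof.
move=> w_epi; rewrite leNgt; apply/negP => Lw.
have D0 : 0 < dot w.1 w.1 - L * `|w.1|.
  rewrite subr_gt0 (lt_le_trans _ (sqr_norm_le_dot w.1))// expr2.
  by rewrite ltr_pM2r// (le_lt_trans L_ge0).
set D := _ - _ in D0.
have bound s : 0 < s -> s * D <= w.2 + sigma 0.
  move=> s0; have := w_epi (s *: w.1); have := sigma_lip (s *: w.1) 0.
  rewrite subr0 normrZ (gtr0_norm s0) ler_norml => /andP[_].
  by rewrite dotZl /D; nra.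
have s0 : 0 < (`|w.2 + sigma 0| + 1) / D by rewrite divr_gt0// ltr_pwDr.
have {bound} := bound _ s0; rewrite divfK ?gt_eqF//.
by have := ler_norm (w.2 + sigma 0); lra.
Qed.

Lemma closed_conj_epi : closed (conj_epi sigma).
Proof.
have -> : conj_epi sigma =
    \bigcap_(x in setT) [set w : 'rV[R]_n * R | dot x w.1 - sigma x <= w.2].
  by apply/seteqP; split => w h x; [move=> _|]; exact: h.
apply: closed_bigI => x _.
apply: (@closed_le_fun R _ (fun w : 'rV[R]_n * R => dot x w.1 - sigma x) snd).
  move=> w; apply: cvgB; last exact: cvg_cst.
  by apply: continuous_dot => w'; [exact: cst_continuous|exact: cvg_fst].
by move=> w; exact: cvg_snd.
Qed.

Lemma continuous_gain B x : continuous B -> continuous (gain B x).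
Proof.
move=> cB w; apply: cvgB; last first.
  apply: (@continuous_comp _ _ _ fst B); [exact: cvg_fst|exact: cB].
apply: cvgB; last exact: cvg_snd.
by apply: continuous_dot => w'; [exact: cst_continuous|exact: cvg_fst].
Qed.

(** Points at least as good as a fixed feasible [w0] have bounded slope and height, so they lie in
    the compact part [K] of the epigraph. [F] is the whole space for existence, and the slopes far
    from a given one for the gap below. *)
Lemma constrained_maximizer B x (F : set 'rV[R]_n) : continuous B -> closed F ->
  (exists2 w, conj_epi sigma w & F w.1) ->
  exists w, [/\ conj_epi sigma w, F w.1 & forall w', conj_epi sigma w' ->
    F w'.1 -> gain B x w' <= gain B x w].
Proof.
move=> cB cF [w0 w0_epi Fw0].
have [q0 _ q0_min] : exists2 c, c \in [set q | `|q| <= L] &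
    forall q, q \in [set q | `|q| <= L] -> B c <= B q.
  apply: EVT_min_rV.
  - by exists w0.1; exact: conj_epi_norm_le.
  - exact: compact_norm_ball.
  - exact: continuous_subspaceT.
pose M := n%:R * `|x| * L - B q0 - gain B x w0.
have w2_le w : conj_epi sigma w -> gain B x w0 <= gain B x w -> w.2 <= M.
  move=> w_epi; have wL := conj_epi_norm_le _ w_epi.
  have := q0_min w.1; rewrite inE => /(_ wL).
  have := le_trans (ler_norm _) (norm_dot_le x w.1).
  have : n%:R * `|x| * `|w.1| <= n%:R * `|x| * L by rewrite ler_wpM2l ?mulr_ge0.
  by rewrite /M /gain; lra.
pose K := [set w | [/\ conj_epi sigma w, F w.1 & w.2 <= M]].
have K_compact : compact K.
  apply: (@subclosed_compact _ _ ([set q | `|q| <= L] `*` `[- sigma 0, M])).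
  - have -> : K = conj_epi sigma `&` (fst @^-1` F `&` [set w | w.2 <= M]).
      by apply/seteqP; split => w [? // []].
    apply: closedI; first exact: closed_conj_epi.
    apply: closedI.
      by apply: preimage_closed => // w _; exact: cvg_fst.
    apply: (@closed_le_fun R _ snd (fun=> M)); first by move=> w; exact: cvg_snd.
    exact: cst_continuous.
  - by apply: compact_setX; [exact: compact_norm_ball|exact: segment_compact].
  - move=> w [w_epi _ wM]; split; first exact: conj_epi_norm_le.
    rewrite /= in_itv/= wM andbT.
    by have := w_epi 0; rewrite dot0l sub0r.
have [w wK w_max] : exists2 w, w \in K & forall w', w' \in K ->
    gain B x w' <= gain B x w.
  apply: compact_EVT_max => //.
    by exists w0; split=> //; exact: w2_le.
  exact/continuous_subspaceT/continuous_gain.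
have w0K : w0 \in K by rewrite inE; split=> //; exact: w2_le.
have w0w := w_max _ w0K.
move: wK; rewrite inE => -[w_epi Fw _]; exists w; split=> // w' w'_epi Fw'.
have [le|lt] := leP (gain B x w0) (gain B x w').
  by apply: w_max; rewrite inE; split=> //; exact: w2_le.
by apply: le_trans w0w; exact: ltW.
Qed.

Lemma maximizer_exists B x : continuous B -> conj_epi sigma !=set0 ->
  exists w, is_maximizer (sigma := sigma) B x w.
Proof.
move=> cB [w0 w0_epi].
have [|w [w_epi _ w_max]] := @constrained_maximizer B x setT cB closedT.
  by exists w0.
by exists w; split=> // w' w'_epi; exact: w_max.
Qed.

(** Among the competitors with slope at distance at least [eta] a best one exists, and uniqueness
    makes it strictly worse than [w0]. If there are none, any positive gap serves. *)
Lemma unique_maximizer_gap B x w0 (eta : R) : continuous B ->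
  is_maximizer (sigma := sigma) B x w0 ->
  at_most_one_maximizer (sigma := sigma) B x -> 0 < eta ->
  exists2 gap, 0 < gap & forall w, conj_epi sigma w ->
    eta <= `|w.1 - w0.1| -> gain B x w <= gain B x w0 - gap.
Proof.
move=> cB w0_max uniq eta0; pose F := [set q : 'rV[R]_n | eta <= `|q - w0.1|].
have cF : closed F.
  apply: (@closed_le_fun R _ (fun=> eta) (fun q => `|q - w0.1|)).
    exact: cst_continuous.
  move=> q; apply: (@continuous_comp _ _ _ (fun q => q - w0.1) Num.norm).
    by apply: continuousB; [exact: cvg_id|exact: cst_continuous].
  exact: norm_continuous.
have [F0|nF] := pselect (exists2 w, conj_epi sigma w & F w.1); last first.
  by exists 1 => // w w_epi Fw; exfalso; apply: nF; exists w.
have [w1 [w1_epi Fw1 w1_max]] := constrained_maximizer B x F cB cF F0.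
exists (gain B x w0 - gain B x w1).
  rewrite subr_gt0 ltNge; apply/negP => w01.
  have w1w0 : w1 = w0.
    apply: uniq => //; split=> // w' w'_epi.
    by apply: le_trans w01; exact: w0_max.2.
  by move: Fw1; rewrite /F /= w1w0 subrr normr0 leNgt eta0.
by move=> w w_epi Fw; have := w1_max _ w_epi Fw; lra.
Qed.

End ConjugateEpigraph.

(* [x] minimizes [theta * phi + psi] over [K]. The slope [- theta * p x] is a
   subgradient of [psi] at the auxiliary point [y], which may lie outside [K];
   optimality of [x] in the direction of [y] makes it a subgradient at [x]. *)
Lemma variational_point {R : realType} {n : nat} (K : set 'rV[R]_n)
    (phi psi : 'rV[R]_n -> R) (theta : R) (p : 'rV[R]_n -> 'rV[R]_n)
    (c : 'rV[R]_n -> R) :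
  K !=set0 -> compact K ->
  (forall x y s, K x -> K y -> 0 <= s <= 1 -> K (x + s *: (y - x))) ->
  {within K, continuous phi} -> continuous psi ->
  (forall x, K x -> is_grad phi x (p x)) ->
  (forall x y s, 0 <= s <= 1 ->
    psi (x + s *: (y - x)) <= psi x + s * (psi y - psi x)) ->
  0 < theta ->
  (forall x z, K x -> c x - theta * dot z (p x) <= psi z) ->
  (forall x, K x -> exists y s, [/\ 0 < s <= 1, K (x + s *: (y - x)) &
    psi y = c x - theta * dot y (p x)]) ->
  exists2 x, K x & psi x = c x - theta * dot x (p x).
Proof.
move=> K0 cK K_cvx cphi cpsi phi_grad psi_cvx theta0 psi_ge psi_eq.
have [x xK x_min] : exists2 x, x \in K & forall z, z \in K ->
    theta * phi x + psi x <= theta * phi z + psi z.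
  apply: (@EVT_min_rV R n (fun z => theta * phi z + psi z) K) => // z.
  apply: cvgD; last exact: continuous_subspaceT.
  by apply: cvgM; [exact: cvg_cst|exact: cphi].
move: xK; rewrite inE => Kx; exists x => //.
have [y [s [/andP[s0 s1] Ky y_eq]]] := psi_eq x Kx.
(* Going the fraction [r * s] of the way to [y] cannot decrease [theta * phi + psi], and by
   convexity [psi] changes by at most [r * s * (psi y - psi x)]; this bounds the slope of [phi] from
   below. *)
have tph : theta^-1 * (psi x - psi y) <= dot (p x) (y - x).
  rewrite -(ler_pM2l s0) -dotZr.
  apply: is_grad_dir_ge (phi_grad x Kx) _; exists 1 => // r /andP[r0 r1].
  rewrite scalerA.
  have rs : 0 <= r * s <= 1 by apply/andP; split; nra.
  have Kz : K (x + (r * s) *: (y - x)).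
    have := K_cvx x (x + s *: (y - x)) r Kx Ky.
    by rewrite addrAC subrr add0r scalerA; apply; rewrite !ltW.
  have := x_min (x + (r * s) *: (y - x)); rewrite inE => /(_ Kz).
  have := psi_cvx x y (r * s) rs.
  set A := phi (x + _); set A' := psi (x + _) => h1 h2.
  rewrite -(ler_pM2l theta0) !mulrA.
  have -> : theta * r * s / theta = r * s by field; rewrite gt_eqF.
  by lra.
apply/le_anti/andP; split; last exact: psi_ge.
move: tph; rewrite -(ler_pM2l theta0) mulrA divff ?gt_eqF// mul1r.
by rewrite !dotE y_eq !(dotC (p x)); lra.
Qed.

(** * Lipschitz continuity and calculus of directional gradients *)

Lemma lipschitz_continuous_fun {R : realType} {n : nat} (f : 'rV[R]_n -> R) (C : R) :
  0 <= C -> (forall x y, `|f x - f y| <= C * `|x - y|) -> continuous f.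
Proof.
move=> C0 f_lip x; apply/(@cvgrPdist_lt R R^o _ (nbhs x) _ f (f x)) => e e0.
have d0 : 0 < e / (C + 1) by rewrite divr_gt0// ltr_wpDl.
apply/nbhs_ballP; exists (e / (C + 1)) => //= y xy.
have {}xy : `|x - y| < e / (C + 1) by move: xy; rewrite -ball_normE.
rewrite (le_lt_trans (f_lip x y))//.
have := normr_ge0 (x - y); move: xy; rewrite ltr_pdivlMr ?ltr_wpDl//; nra.
Qed.

Lemma is_grad_unique {R : realType} {n : nat} (f : 'rV[R]_n -> R) x a b :
  is_grad f x a -> is_grad f x b -> a = b.
Proof.
have dir_le c c' d : is_grad f x c -> is_grad f x c' -> dot c d <= dot c' d.
  move=> fc fc'; apply/ler_addgt0Pr => e e0; apply: is_grad_dir_le fc _.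
  have [s0 s0_gt0 h] := fc' d e e0; exists s0 => // s /h.
  by rewrite ler_norml => /andP[_]; lra.
move=> fa fb; apply/subr0_eq/dotxx_eq0; apply/le_anti; rewrite dotxx_ge0 andbT.
by rewrite dotDl dotNl subr_le0; exact: dir_le.
Qed.

Lemma is_gradB {R : realType} {n : nat} (f g : 'rV[R]_n -> R) x a b :
  is_grad f x a -> is_grad g x b -> is_grad (f \- g) x (a - b).
Proof.
move=> fa gb d e e0; have e20 : 0 < e / 2 by lra.
have [s1 s1_gt0 h1] := fa d _ e20; have [s2 s2_gt0 h2] := gb d _ e20.
exists (Num.min s1 s2); first by rewrite lt_min s1_gt0.
move=> s /andP[s0]; rewrite lt_min => /andP[ss1 ss2].
have {}h1 := h1 s; have {}h2 := h2 s; rewrite s0 ss1 in h1; rewrite s0 ss2 in h2.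
move: (h1 isT) (h2 isT); rewrite !ler_norml !dotE /= => /andP[? ?] /andP[? ?].
by apply/andP; split; lra.
Qed.

Lemma is_grad_affine {R : realType} {n : nat} (f : 'rV[R]_n -> R) x a (k c : R) :
  is_grad f x a -> is_grad (fun z => k * f z + c) x (k *: a).
Proof.
move=> fa d e e0; have k0 : 0 < `|k| + 1 by rewrite ltr_wpDl.
have [s0 s0_gt0 h] := fa d (e / (`|k| + 1)) (divr_gt0 e0 k0).
exists s0 => // s sI; move: (h s sI); case/andP: sI => s_gt0 _.
rewrite mulrA ler_pdivlMr// => {}h.
have -> : k * f (x + s *: d) + c - (k * f x + c) - s * dot (k *: a) d =
  k * (f (x + s *: d) - f x - s * dot a d) by rewrite dotZl; ring.
by rewrite normrM; apply: le_trans h; rewrite mulrC ler_wpM2l// lerDl.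
Qed.

(** * Uniqueness at (t0, x0) from differentiability on a ball at time t1 *)

Section Propagation.
Context {R : realType} {n : nat} {sigma : 'rV[R]_n -> R} {L : R}.
Hypothesis L_ge0 : 0 <= L.
Hypothesis sigma_lip : forall x y, `|sigma x - sigma y| <= L * `|x - y|.
Hypothesis sigma_convex : forall x y (s : R), 0 <= s <= 1 ->
  sigma (x + s *: (y - x)) <= sigma x + s * (sigma y - sigma x).
Variable dsigma : 'rV[R]_n -> 'rV[R]_n.
Hypothesis dsigma_grad : forall x, is_grad sigma x (dsigma x).

(** [B0] and [B1] stand for the actions at the times t0 and t1, and [phi] for u(t1, .). By
    [dB_close] a characteristic moves by at most [eps] between these times. *)
Variables (B0 B1 : 'rV[R]_n -> R) (dB0 dB1 : 'rV[R]_n -> 'rV[R]_n).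
Hypothesis dB0_grad : forall q, is_grad B0 q (dB0 q).
Hypothesis dB1_grad : forall q, is_grad B1 q (dB1 q).
Variables (x0 : 'rV[R]_n) (eps : R).
Hypothesis eps_ge0 : 0 <= eps.
Hypothesis dB_close : forall q, `|q| <= L -> enorm (dB1 q - dB0 q) <= eps.

Variable phi : 'rV[R]_n -> R.
Hypothesis phi_value : forall x, exists2 w,
  is_maximizer (sigma := sigma) B1 x w & phi x = gain B1 x w.

Local Notation K := [set x | enorm (x - x0) <= eps].
Hypothesis phi_diff : forall x, K x -> exists a, is_grad phi x a.

Lemma value_eq_gain x w : is_maximizer (sigma := sigma) B1 x w ->
  phi x = gain B1 x w.
Proof.
move=> [w_epi w_max]; have [w' [w'_epi w'_max] ->] := phi_value x.
by apply/le_anti; rewrite w_max// w'_max.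
Qed.

(** The maximizer at [x] competes at [y], where its gain differs by a linear term only. *)
Lemma value_ge x y w : is_maximizer (sigma := sigma) B1 x w ->
  phi x + dot w.1 (y - x) <= phi y.
Proof.
move=> w_max; rewrite (value_eq_gain x w w_max).
have [w' w'_max ->] := phi_value y; apply: le_trans (w'_max.2 w w_max.1).
by rewrite /gain (dotC w.1) !dotE; lra.
Qed.

Lemma value_continuous : continuous phi.
Proof.
have half x y : phi x - phi y <= n%:R * L * `|x - y|.
  have [w w_max _] := phi_value x; have := value_ge x y w w_max.
  have := le_trans (ler_norm _) (norm_dot_le w.1 (x - y)).
  have : n%:R * `|w.1| * `|x - y| <= n%:R * L * `|x - y|.
    by rewrite ler_wpM2r// ler_wpM2l// (conj_epi_norm_le L_ge0 sigma_lip _ w_max.1).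
  by rewrite !dotE; lra.
apply: (@lipschitz_continuous_fun _ _ _ (n%:R * L)); first exact: mulr_ge0.
by move=> x y; rewrite ler_norml lerNl opprB half distrC half.
Qed.

Lemma maximizer_grad x w : K x -> is_maximizer (sigma := sigma) B1 x w ->
  is_grad phi x w.1.
Proof.
move=> Kx w_max; have [a phia] := phi_diff x Kx.
suff -> : w.1 = a by [].
by apply: is_grad_subgrad phia _ => z; exact: value_ge.
Qed.

Lemma maximizer_unique x : K x -> at_most_one_maximizer (sigma := sigma) B1 x.
Proof.
move=> Kx w1 w2 m1 m2; have e1 : w1.1 = w2.1.
  by apply: (@is_grad_unique _ _ phi x); apply: maximizer_grad.
have := value_eq_gain x w1 m1; rewrite (value_eq_gain x w2 m2) /gain e1 => e2.
by rewrite [w1]surjective_pairing [w2]surjective_pairing e1; congr (_, _); lra.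
Qed.

Lemma enorm_ball_convex x y s : K x -> K y -> 0 <= s <= 1 -> K (x + s *: (y - x)).
Proof.
have KE z : K z <-> dot (z - x0) (z - x0) <= eps ^+ 2.
  rewrite /= /enorm -[eps in X in X <-> _]ger0_norm// -sqrtr_sqr.
  by rewrite ler_sqrt// exprn_ge0.
move=> /KE Kx /KE Ky /andP[s0 s1]; apply/KE.
(* Uses |(1-s)a + sb|^2 = (1-s)|a|^2 + s|b|^2 - s(1-s)|a-b|^2 with a = [x - x0] and b = [y - x0]. *)
have := dotxx_ge0 (x - y); move: Kx Ky.
rewrite !dotE !(dotC x0) (dotC y x).
have : 0 <= s * (1 - s) by apply: mulr_ge0; lra.
by nra.
Qed.

(** At the variational point [x] the bound by [psi x] is attained by the maximizer [w x]. For a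
    maximizer [w1] at [x0] the same bound then gives [gain B1 x w1 >= gain B1 x (w x)], so [w1] is
    also a maximizer for [B1] at [x], where uniqueness is known. *)
Lemma maximizer_unique_of_potential (theta : R) (psi : 'rV[R]_n -> R) :
  0 < theta -> continuous psi ->
  (forall x y s, 0 <= s <= 1 ->
    psi (x + s *: (y - x)) <= psi x + s * (psi y - psi x)) ->
  (forall x w, conj_epi sigma w -> gain B0 x0 w - theta * gain B1 x w <= psi x) ->
  (forall x w, K x -> is_maximizer (sigma := sigma) B1 x w ->
    exists y s, [/\ 0 < s <= 1, K (x + s *: (y - x)) &
      psi y = gain B0 x0 w - theta * gain B1 y w]) ->
  at_most_one_maximizer (sigma := sigma) B0 x0.
Proof.
move=> theta0 cpsi psi_cvx psi_ge psi_eq.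
have [w w_max] : {w & forall x, is_maximizer (sigma := sigma) B1 x (w x)}.
  apply: (@choice _ _ (fun x w => is_maximizer (sigma := sigma) B1 x w)) => x.
  by have [w m _] := phi_value x; exists w.
(* The part of [gain B0 x0 (w x) - theta * gain B1 z (w x)] that does not depend on [z]. *)
pose c x := gain B0 x0 (w x) + theta * ((w x).2 + B1 (w x).1).
have cE x z : c x - theta * dot z (w x).1 = gain B0 x0 (w x) - theta * gain B1 z (w x).
  by rewrite /c /gain; ring.
have [|||||x Kx psi_x] := @variational_point _ _ K phi psi theta (fun x => (w x).1) c
    _ (compact_enorm_ball x0 eps) enorm_ball_convex _ cpsi _ psi_cvx theta0.
- by exists x0; rewrite /= subrr /enorm dot0l sqrtr0.
- exact/continuous_subspaceT/value_continuous.
- by move=> x Kx; exact: maximizer_grad.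
- by move=> x z _; rewrite cE; apply: psi_ge; exact: (w_max x).1.
- move=> x Kx; have [y [s [s01 Ky y_eq]]] := psi_eq x (w x) Kx (w_max x).
  by exists y, s; split; rewrite ?cE.
suff wx w1 : is_maximizer (sigma := sigma) B0 x0 w1 -> w1 = w x.
  by move=> w1 w2 /wx-> /wx->.
move=> [w1_epi w1_max]; apply: (maximizer_unique x) => //.
split=> // w2 w2_epi; apply: le_trans ((w_max x).2 _ w2_epi) _.
rewrite -(ler_pM2l theta0); have := psi_ge x w1 w1_epi; rewrite psi_x cE.
by have := w1_max _ (w_max x).1; lra.
Qed.

(** With theta = 1 the heights cancel in [gain B0 x0 w - gain B1 x w], which becomes
    [dot (x0 - x) w.1 + G w.1]; its maximum over the slopes bounded by [L] is the potential. *)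
Lemma maximizer_unique_concave :
  (forall p q s, 0 <= s <= 1 ->
     (B1 \- B0) p + s * ((B1 \- B0) q - (B1 \- B0) p) <=
     (B1 \- B0) (p + s *: (q - p))) ->
  continuous (B1 \- B0) ->
  at_most_one_maximizer (sigma := sigma) B0 x0.
Proof.
set G := B1 \- B0 => G_ccv cG.
pose Q := [set q : 'rV[R]_n | `|q| <= L].
pose f x q := dot (x0 - x) q + G q.
have Q_norm w : conj_epi sigma w -> Q w.1.
  exact: (conj_epi_norm_le L_ge0 sigma_lip).
have [qmax qmaxP] : {qmax : 'rV[R]_n -> 'rV[R]_n & forall x,
    Q (qmax x) /\ forall q, Q q -> f x q <= f x (qmax x)}.
  apply: (@choice _ _ (fun x qx => Q qx /\ forall q, Q q -> f x q <= f x qx)) => x.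
  have [||q qQ q_max] := @EVT_max_rV R n (f x) Q _ (compact_norm_ball L).
  - by exists 0; rewrite /Q /= normr0.
  - apply: continuous_subspaceT => q; apply: continuousD; last exact: cG.
    by apply: continuous_dot => q'; [exact: cst_continuous|exact: cvg_id].
  - exists q; split; first by rewrite inE in qQ.
    by move=> q' Qq'; apply: q_max; rewrite inE.
(* [psi x] is the conjugate of the convex function [- G] at [x0 - x]. *)
pose psi x := f x (qmax x).
have psi_ge x q : Q q -> f x q <= psi x by exact: (qmaxP x).2.
apply: (@maximizer_unique_of_potential 1 psi) => //.
- have half x y : psi x - psi y <= n%:R * L * `|x - y|.
    have := psi_ge y (qmax x) (qmaxP x).1.
    have := le_trans (ler_norm _) (norm_dot_le (y - x) (qmax x)).
    have : n%:R * `|y - x| * `|qmax x| <= n%:R * L * `|x - y|.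
      by rewrite distrC mulrAC ler_wpM2r// ler_wpM2l// (qmaxP x).1.
    by rewrite /psi /f !dotE; lra.
  apply: (@lipschitz_continuous_fun _ _ _ (n%:R * L)); first exact: mulr_ge0.
  by move=> x y; rewrite ler_norml lerNl opprB half distrC half.
- move=> x y s /andP[s0 s1]; set z := x + _.
  have hx := psi_ge x _ (qmaxP z).1; have hy := psi_ge y _ (qmaxP z).1.
  have -> : psi z = f z (qmax z) by [].
  have -> : f z (qmax z) = (1 - s) * f x (qmax z) + s * f y (qmax z).
    by rewrite /f {1}/z !dotE; ring.
  by nra.
- move=> x w /Q_norm Qw; have := psi_ge x _ Qw.
  by rewrite /f /G /gain /= !dotE; lra.
(* At this point [y] the gradient of [f y] vanishes at [w.1], so concavity of [G] makes [w.1] a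
   global maximizer of [f y]. Since [y] lies in the ball, the full step [s = 1] is allowed. *)
- move=> x w Kx [w_epi _]; exists (x0 + (dB1 w.1 - dB0 w.1)), 1.
  have Qw := Q_norm w w_epi.
  have dG : is_grad G w.1 (dB1 w.1 - dB0 w.1) by exact: is_gradB.
  split; first by rewrite ltr01 lexx.
    by rewrite /= scale1r addrCA subrr addr0 addrAC subrr add0r; exact: dB_close.
  apply/le_anti/andP; split; last first.
    have := psi_ge (x0 + (dB1 w.1 - dB0 w.1)) _ Qw.
    by rewrite /f /G /gain /= !dotE; lra.
  set y := x0 + _; have -> : psi y = f y (qmax y) by [].
  move: (qmax y) => q.
  have : G q - G w.1 <= dot (dB1 w.1 - dB0 w.1) (q - w.1).
    apply: is_grad_dir_ge dG _; exists 1 => // s /andP[s0 s1].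
    have s01 : 0 <= s <= 1 by rewrite !ltW.
    by have := G_ccv w.1 q s s01; lra.
  by rewrite /y /f /gain /G /= !dotE; lra.
Qed.

(** In [gain B0 x0 w - theta * gain B1 x w] the [B1] terms cancel. What remains is [(1 - theta) *
    (dot (foot x) w.1 - w.2) - c], and Fenchel's inequality at [foot x] bounds it by [psi x]. *)
Lemma maximizer_unique_proportional (theta c : R) : 0 < theta < 1 ->
  (forall q, B0 q = theta * B1 q + c) ->
  at_most_one_maximizer (sigma := sigma) B0 x0.
Proof.
move=> /andP[theta0 theta1] B01.
have th' : 0 < 1 - theta by lra.
have dB01 q : dB0 q = theta *: dB1 q.
  apply: is_grad_unique (dB0_grad q) _.
  by rewrite (_ : B0 = fun z => theta * B1 z + c); [exact: is_grad_affine|exact/funext].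
(* [foot x] is the point with [x0 = (1 - theta) foot x + theta x]. *)
pose foot x := (1 - theta)^-1 *: (x0 - theta *: x).
have footE x : (1 - theta) *: foot x = x0 - theta *: x.
  by rewrite scalerA divff ?gt_eqF// scale1r.
have footM x y s : foot (x + s *: (y - x)) = foot x + s *: (foot y - foot x).
  rewrite /foot -scalerBr scalerA mulrC -scalerA -scalerDr; congr (_ *: _).
  by apply/rowP => i; rewrite !mxE; ring.
pose psi x := (1 - theta) * sigma (foot x) - c.
apply: (@maximizer_unique_of_potential theta psi) => //.
- apply: (@lipschitz_continuous_fun _ _ _ (L * theta)) => [|x y].
    by rewrite mulr_ge0// ltW.
  have -> : psi x - psi y = (1 - theta) * (sigma (foot x) - sigma (foot y)).
    by rewrite /psi; ring.
  rewrite normrM gtr0_norm//; apply: le_trans (_ : _ <= (1 - theta) * _) _.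
    by rewrite ler_pM2l//; exact: sigma_lip.
  rewrite mulrCA -mulrA ler_wpM2l// -{1}(gtr0_norm th') -normrZ scalerBr !footE.
  have -> : x0 - theta *: x - (x0 - theta *: y) = theta *: (y - x).
    by apply/rowP => i; rewrite !mxE; ring.
  by rewrite normrZ gtr0_norm// distrC.
- move=> x y s s01; rewrite /psi footM.
  by have := sigma_convex (foot x) (foot y) s s01; nra.
- move=> x w w_epi; have := w_epi (foot x); rewrite -(ler_pM2l th') mulrBr.
  by rewrite -dotZl footE /psi /gain B01 !dotE; lra.
- move=> x w Kx w_max.
  have := maximizer_foot sigma_convex _ dsigma_grad _ _ _ _ (dB1_grad w.1) w_max.
  set y' := x - _ => y'_eq.
  (* Fenchel's inequality is an equality at the initial point [y'] of the characteristic, so [y] is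
     chosen with [foot y = y']. The fraction [theta] of the way from [x] to [y] ends at
     [x0 + (dB1 w.1 - dB0 w.1)], which lies in the ball. *)
  have y'E : foot (theta^-1 *: (x0 - (1 - theta) *: y')) = y'.
    by rewrite /foot scalerA divff ?gt_eqF// scale1r opprB addrCA subrr addr0
      scalerA mulVf ?gt_eqF// scale1r.
  exists (theta^-1 *: (x0 - (1 - theta) *: y')), theta.
  split; first by rewrite theta0 ltW.
    rewrite /= scalerBr scalerA divff ?gt_eqF// scale1r.
    have -> : x + (x0 - (1 - theta) *: y' - theta *: x) - x0 =
        dB1 w.1 - dB0 w.1.
      by rewrite dB01 /y'; apply/rowP => i; rewrite !mxE; ring.
    exact/dB_close/(conj_epi_norm_le L_ge0 sigma_lip _ w_max.1).
  rewrite /psi y'E -y'_eq /gain B01 dotZl !dotE.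
  by field; rewrite gt_eqF.
Qed.

End Propagation.

(** * Differentiability through first-order expansions *)

Section Differentiability.
Context {R : realType}.

Lemma differentiable_expansion (V W : normedModType R) (f : V -> W) (z : V) :
  differentiable f z -> forall e : R, 0 < e ->
  \forall w \near z, `|f w - f z - 'd f z (w - z)| <= e * `|w - z|.
Proof.
move=> /diff_locallyP[_ fz] e e0.
have /eqaddoP/(_ e e0) := fz.
rewrite [X in _ -> X](near_shift 0 z); apply: filterS => w /=.
by rewrite subr0 addrK opprD addrA.
Qed.

Lemma expansion_differentiable (V W : normedModType R) (f : V -> W) (z : V)
    (df : {linear V -> W}) : continuous df ->
  (forall e : R, 0 < e ->
    \forall w \near z, `|f w - f z - df (w - z)| <= e * `|w - z|) ->
  differentiable f z.
Proof.
move=> cdf f_exp.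
apply/diffP.
(* The differential is selected by choice among the continuous linear expansions, so exhibiting [df]
   suffices. *)
apply: (@getPex _ (fun (df : {linear V -> W}) => continuous df /\
  forall y, f y = f (lim (nbhs z)) + df (y - lim (nbhs z))
                  +o_(y \near z) (y - lim (nbhs z)))).
exists df; split=> //; rewrite lim_id; last exact: norm_hausdorff.
have : f = (fun y => f z + df (y - z)) +o_z (fun y => y - z).
  apply/eqaddoP => e /f_exp; apply: filterS => w /=.
  by rewrite opprD addrA.
by rewrite funeqE.
Qed.

Lemma expansion_dir (E : normedModType R) (A : set E) (f : E -> R) (z v : E)
    (df : {linear E -> R}) : (forall s : R, A (z + s *: v)) ->
  (forall e : R, 0 < e -> \forall w \near within A (nbhs z),
    `|f w - f z - df (w - z)| <= e * `|w - z|) ->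
  forall e : R, 0 < e -> exists2 s0 : R, 0 < s0 & forall s, `|s| < s0 ->
    `|f (z + s *: v) - f z - s * df v| <= `|s| * e.
Proof.
move=> Av f_exp e e0.
have v0 : 0 < `|v| + 1 by rewrite ltr_wpDl.
have /nbhs_ballP[r /= r0 near_z] := f_exp _ (divr_gt0 e0 v0).
exists (r / (`|v| + 1)); first exact: divr_gt0.
move=> s; rewrite ltr_pdivlMr// => sr.
have := near_z (z + s *: v) _ (Av s).
rewrite -ball_normE /= opprD addNKr normrN normrZ => near_s.
have zs : `|s| * `|v| < r.
  by apply: le_lt_trans sr; rewrite ler_wpM2l// lerDl.
have {near_s} := near_s zs.
have -> : z + s *: v - z = s *: v by rewrite addrAC subrr add0r.
rewrite linearZ/= normrZ => /le_trans; apply.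
rewrite mulrCA ler_wpM2l// mulrAC ler_pdivrMr//.
by rewrite ler_wpM2l ?ltW// ltrDl.
Qed.

(** With h = H(t, q) this is the candidate differential of u: slope [q] in space and, by the
    Hamilton-Jacobi equation, [- h] in time. *)
Definition spacetime_form {n : nat} (h : R) (q : 'rV[R]_n) (z : R * 'rV[R]_n) : R :=
  dot z.2 q - z.1 * h.

Lemma spacetime_form_is_linear (n : nat) (h : R) (q : 'rV[R]_n) :
  linear (spacetime_form h q).
Proof. by move=> k x y; rewrite /spacetime_form /= !dotE /GRing.scale/=; ring. Qed.

HB.instance Definition _ (n : nat) (h : R) (q : 'rV[R]_n) :=
  GRing.isLinear.Build R (R * 'rV[R]_n)%type R _ (spacetime_form h q)
    (spacetime_form_is_linear n h q).


Lemma continuous_spacetime_form (n : nat) (h : R) (q : 'rV[R]_n) :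
  continuous (spacetime_form h q).
Proof.
move=> z; apply: cvgB.
  by apply: continuous_dot => y; [exact: cvg_snd|exact: cst_continuous].
by apply: cvgM; [exact: cvg_fst|exact: cvg_cst].
Qed.

End Differentiability.

(** * Differentiability of the value where the maximizer is unique *)

Section ValueDifferentiable.
Context {R : realType} {n : nat} {sigma : 'rV[R]_n -> R} {L : R}.
Hypothesis L_ge0 : 0 <= L.
Hypothesis sigma_lip : forall x y, `|sigma x - sigma y| <= L * `|x - y|.

(** An envelope argument: near (t0, x0) every maximizer has slope close to [w0.1]. Letting [w] and
    [w0] compete in each other's problem squeezes the increment of [u] between the increments of
    their two gains, which share the same first-order part. *)
Lemma value_differentiable (A : R -> 'rV[R]_n -> R) (h : 'rV[R]_n -> R)
    (u : R * 'rV[R]_n -> R) (t0 : R) (x0 : 'rV[R]_n) (C : R) :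
  0 <= C -> continuous (A t0) ->
  (\forall z \near (t0, x0), exists2 w,
    is_maximizer (sigma := sigma) (A z.1) z.2 w & u z = gain (A z.1) z.2 w) ->
  (\forall t \near t0, forall q, `|q| <= L -> `|A t q - A t0 q| <= C * `|t - t0|) ->
  (forall q0 (e : R), 0 < e -> exists2 eta, 0 < eta & forall t q,
    `|t - t0| < eta -> `|q - q0| < eta ->
    `|A t q - A t0 q - (t - t0) * h q0| <= e * `|t - t0|) ->
  at_most_one_maximizer (sigma := sigma) (A t0) x0 ->
  differentiable u (t0, x0).
Proof.
move=> C_ge0 cA u_value A_lip A_exp uniq.
have [w0 w0_max u0] := nbhs_singleton u_value; rewrite /= in w0_max u0.
pose form : {linear (R * 'rV[R]_n)%type -> R} := spacetime_form (h w0.1) w0.1.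
apply: (@expansion_differentiable R _ _ u (t0, x0) form).
  exact: continuous_spacetime_form.
move=> e e0; have n1 : 0 < n%:R + 1 :> R by rewrite ltr_wpDl.
(* The change of slope contributes [n%:R * e1 * d] through the inner product and the action
   contributes [e1 * d]; together these are [e * d]. *)
pose e1 := e / (n%:R + 1); have e10 : 0 < e1 by exact: divr_gt0.
have [eta1 eta10 A_exp1] := A_exp w0.1 e1 e10.
pose eta := Num.min eta1 e1.
have eta0 : 0 < eta by rewrite lt_min eta10.
have [gap gap0 gapP] := unique_maximizer_gap L_ge0 sigma_lip _ _ _ _ cA w0_max uniq eta0.
(* Moving from (t0, x0) to [z] changes the gain of any epigraph point by at most [k] times the
   distance. Within radius [r] two such changes stay below [gap], which forces the maximizer at [z]
   to be close to [w0]. *)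
pose k := C + n%:R * L.
have k0 : 0 <= k by rewrite addr_ge0// mulr_ge0.
pose r := Num.min eta1 (gap / (2 * k + 1)).
have r0 : 0 < r by rewrite lt_min eta10 divr_gt0// ltr_wpDl// mulr_ge0.
have near_r : \forall z \near (t0, x0), `|z - (t0, x0)| < r.
  apply/nbhs_ballP; exists r => //= z; rewrite -ball_normE /=.
  by rewrite distrC.
have near_t : \forall z \near (t0, x0),
    forall q, `|q| <= L -> `|A z.1 q - A t0 q| <= C * `|z.1 - t0|.
  exact: (@cvg_fst _ _ (nbhs t0) (nbhs x0) _ _ A_lip).
near=> z.
have [w w_max uz] : exists2 w, is_maximizer (sigma := sigma) (A z.1) z.2 w &
  u z = gain (A z.1) z.2 w by near: z.
have zr : `|z - (t0, x0)| < r by near: z.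
have Az : forall q, `|q| <= L -> `|A z.1 q - A t0 q| <= C * `|z.1 - t0| by near: z.
have zt : `|z.1 - t0| <= `|z - (t0, x0)|.
  by rewrite [leRHS]prod_normE le_max lexx.
have zx : `|z.2 - x0| <= `|z - (t0, x0)|.
  by rewrite [leRHS]prod_normE le_max lexx orbT.
move: (`|z - (t0, x0)|) zr zt zx => d dr zt zx.
have d0 : 0 <= d by apply: le_trans zt.
have gainB w' : gain (A z.1) z.2 w' - gain (A t0) x0 w' =
    dot (z.2 - x0) w'.1 - (A z.1 w'.1 - A t0 w'.1).
  by rewrite /gain !dotE; ring.
have dot_small q (c : R) : `|q| <= c -> `|dot (z.2 - x0) q| <= n%:R * c * d.
  move=> qc; apply: le_trans (norm_dot_le _ _) _.
  by rewrite mulrAC ler_pM ?mulr_ge0// ler_wpM2l.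
have gain_near w' : conj_epi sigma w' ->
    `|gain (A z.1) z.2 w' - gain (A t0) x0 w'| <= k * d.
  move=> w'_epi; have w'L := conj_epi_norm_le L_ge0 sigma_lip _ w'_epi.
  rewrite gainB (le_trans (ler_normB _ _))// /k mulrDl addrC lerD//.
    by apply: le_trans (Az _ w'L) _; rewrite ler_wpM2l.
  exact: dot_small.
have close : `|w.1 - w0.1| < eta.
  rewrite ltNge; apply/negP => /(gapP w w_max.1).
  have := gain_near w w_max.1; have := gain_near w0 w0_max.1.
  have := w_max.2 w0 w0_max.1.
  have : d * (2 * k + 1) < gap.
    move: dr; rewrite lt_min => /andP[_]; rewrite ltr_pdivlMr//.
    by rewrite ltr_wpDl// mulr_ge0.
  by rewrite !ler_norml => ? ? /andP[? ?] /andP[? ?]; nra.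
have [close1 close_e1] : `|w.1 - w0.1| < eta1 /\ `|w.1 - w0.1| < e1.
  by apply/andP; rewrite -lt_min.
have d_eta1 : `|z.1 - t0| < eta1.
  by apply: le_lt_trans zt _; move: dr; rewrite lt_min => /andP[].
have Aw := A_exp1 z.1 w.1 d_eta1 close1.
have Aw0 : `|A z.1 w0.1 - A t0 w0.1 - (z.1 - t0) * h w0.1| <= e1 * `|z.1 - t0|.
  by apply: A_exp1 => //; rewrite subrr normr0.
have e1d : e1 * `|z.1 - t0| <= e1 * d by rewrite ler_wpM2l// ltW.
have ed : e * d = n%:R * e1 * d + e1 * d.
  by rewrite /e1; field; rewrite gt_eqF.
have dot_w := dot_small (w.1 - w0.1) e1 (ltW close_e1).
have ne1 : 0 <= n%:R * e1 * d by rewrite !mulr_ge0// ltW.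
rewrite uz u0 ed /form /= /spacetime_form /=.
have gw := gainB w; have gw0 := gainB w0.
have m1 := w_max.2 w0 w0_max.1; have m2 := w0_max.2 w w_max.1.
move: Aw Aw0 dot_w gw gw0; rewrite dotDr dotNr.
clear -e1d ne1 m1 m2; rewrite !ler_norml => /andP[? ?] /andP[? ?] /andP[? ?] ? ?.
by apply/andP; split; lra.
Unshelve. all: by end_near. Qed.

End ValueDifferentiable.

(** * The action as a time integral: regularity in slope and time *)

Section Action.
Context {R : realType} {n : nat}.
Local Notation mu := (@lebesgue_measure R).

Lemma continuous_integrable (f : R -> R) (a b : R) : continuous f ->
  mu.-integrable `[a, b] (EFin \o f).
Proof.
move=> cf; apply: continuous_compact_integrable; first exact: segment_compact.
exact: continuous_subspaceT.
Qed.

Lemma Rintegral_segmentB (f : R -> R) (s t : R) : continuous f -> 0 <= s <= t ->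
  \int[mu]_(x in `[0, t]) f x - \int[mu]_(x in `[0, s]) f x =
  \int[mu]_(x in `[s, t]) f x.
Proof.
move=> cf /andP[s0 st].
rewrite Rintegral_itvB ?bnd_simp//; last exact: continuous_integrable.
apply: Rintegral_itv_obnd_cbnd; apply: (@integrableS _ _ _ mu `[s, t]) => //.
  exact: subset_itv_oc_cc.
exact: continuous_integrable.
Qed.

Lemma Rintegral_segment_cst (a b c : R) : a <= b ->
  \int[mu]_(x in `[a, b]) c = c * (b - a).
Proof.
move=> ab; rewrite Rintegral_cst//= lebesgue_measure_itv/= lte_fin.
case: ltP => // ba; have -> : a = b by apply/le_anti; rewrite ab.
by rewrite subrr.
Qed.

Lemma norm_Rintegral_segment_le (f : R -> R) (a b c : R) : continuous f -> a <= b ->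
  (forall x, a <= x <= b -> `|f x| <= c) ->
  `|\int[mu]_(x in `[a, b]) f x| <= c * (b - a).
Proof.
move=> cf ab fc; rewrite -Rintegral_segment_cst//.
apply: le_trans (le_normr_Rintegral _ (continuous_integrable f a b cf)) _ => //.
apply: le_Rintegral => //.
- apply: continuous_integrable => x.
  by apply: (@continuous_comp _ _ _ f Num.norm); [exact: cf|exact: norm_continuous].
- by apply: continuous_integrable => x; exact: cvg_cst.
Qed.

Lemma expansion_is_derive (f : R -> R) (r D : R) :
  (forall e : R, 0 < e -> exists2 s0 : R, 0 < s0 & forall s, `|s| < s0 ->
    `|f (r + s) - f r - s * D| <= `|s| * e) ->
  is_derive r (1 : R) f D.
Proof.
move=> f_exp.
have quot_cvg : h^-1 *: ((f \o shift r) (h *: (1 : R)) - f r) @[h --> 0^'] --> D.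
  apply/cvgrPdist_le => e e0; have [s0 s00 h] := f_exp e e0.
  near=> k.
  have k0 : k != 0 by near: k; exact: nbhs_dnbhs_neq.
  have ks : `|k| < s0.
    near: k; apply: nbhs_dnbhs; apply/nbhs_ballP; exists s0 => //= k.
    by rewrite -ball_normE /= sub0r normrN.
  have := h k ks; rewrite /= /GRing.scale/= mulr1 (addrC k) => fk.
  rewrite -(ler_pM2l (x := `|k|)) ?normr_gt0// -normrM -normrN.
  apply: le_trans fk; rewrite le_eqVlt; apply/orP; left; apply/eqP.
  by congr `| _ |; field.
by apply: DeriveDef; [apply: cvgP quot_cvg|exact: cvg_lim quot_cvg].
Unshelve. all: by end_near. Qed.

Lemma continuous_slice (F : R * 'rV[R]_n -> R) (q : 'rV[R]_n) :
  continuous F -> continuous (fun t => F (t, q)).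
Proof.
move=> cF t; apply: (@continuous_comp _ _ _ (fun t => (t, q)) F); last exact: cF.
apply: (@cvg_pair _ _ _ (nbhs t) (nbhs t) (nbhs q) _ _ _ id (fun=> q)).
  exact: cvg_id.
exact: cvg_cst.
Qed.

(** Compactness of the time segment makes the neighbourhood of [q0] uniform in [t]. *)
Lemma continuous_tube (F : R * 'rV[R]_n -> R) (a b : R) (q0 : 'rV[R]_n) (e : R) :
  continuous F -> 0 < e -> exists2 eta : R, 0 < eta & forall t q, a <= t <= b ->
    `|q - q0| < eta -> `|F (t, q) - F (t, q0)| <= e.
Proof.
move=> cF e0.
have /compact_near_coveringP/(_ _ (nbhs q0)
    (fun q t => `|F (t, q) - F (t, q0)| <= e) _) cover : compact `[a, b].
  exact: segment_compact.
have /nbhs_ballP[eta /= eta0 etaP] : \forall q \near q0,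
    `[a, b] `<=` (fun t => `|F (t, q) - F (t, q0)| <= e).
  apply: cover => t _.
  have e20 : 0 < e / 2 by rewrite divr_gt0.
  have /cvgrPdist_lt/(_ _ e20) := cF (t, q0).
  move=> /nbhs_ballP[r /= r0 near_r].
  exists (ball t r, ball q0 r); first by split; apply: nbhsx_ballx.
  move=> [t' q] /= [tt' qq'].
  have h1 := near_r (t', q) (conj tt' qq').
  have h2 := near_r (t', q0) (conj tt' (ballxx q0 r0)).
  rewrite -(subrKA (F (t, q0))) (le_trans (ler_normD _ _))//.
  by rewrite distrC /= in h1; rewrite /= in h2; lra.
exists eta => // t q tab qq0; apply: etaP; last by rewrite /= in_itv.
by rewrite -ball_normE /= distrC.
Qed.

Lemma compact_cylinder_bound (F : R * 'rV[R]_n -> R) (T L : R) :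
  0 <= T -> 0 <= L -> continuous F ->
  exists2 C, 0 <= C & forall t q, 0 <= t <= T -> `|q| <= L -> `|F (t, q)| <= C.
Proof.
move=> T0 L0 cF; pose K : set (R * 'rV[R]_n) := `[0, T] `*` [set q | `|q| <= L].
have [||z _ z_max] := @compact_EVT_max _ R (fun z => `|F z|) K _
    (compact_setX (@segment_compact _ 0 T) (compact_norm_ball L)).
- by exists (0, 0); split; rewrite /= ?in_itv/= ?lexx ?normr0.
- apply: continuous_subspaceT => z.
  by apply: (@continuous_comp _ _ _ F Num.norm); [exact: cF|exact: norm_continuous].
exists `|F z| => // t q tT qL; apply: (z_max (t, q)).
by rewrite inE; split; rewrite /= ?in_itv.
Qed.

Variables (F : R * 'rV[R]_n -> R) (g : R * 'rV[R]_n -> 'rV[R]_n).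
Hypothesis F_cts : continuous F.
Hypothesis g_cts : forall d, continuous (fun z => dot (g z) d).
Hypothesis F_exp : forall t q d (e : R), 0 < e ->
  exists2 s0 : R, 0 < s0 & forall s, `|s| < s0 ->
    `|F (t, q + s *: d) - F (t, q) - s * dot (g (t, q)) d| <= `|s| * e.

Definition action t q : R := \int[mu]_(tau in `[0, t]) F (tau, q).

Definition action_grad t q : 'rV[R]_n :=
  \row_i \int[mu]_(tau in `[0, t]) g (tau, q) 0 i.

Lemma coord_dot (x : 'rV[R]_n) i : x 0 i = dot x (delta_mx 0 i).
Proof.
rewrite /dot (bigD1 i)//= big1 => [|j ji]; rewrite mxE eqxx/=.
  by rewrite eqxx mulr1 addr0.
by rewrite (negbTE ji) mulr0.
Qed.

Lemma dot_action_grad t q d :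
  dot (action_grad t q) d = \int[mu]_(tau in `[0, t]) dot (g (tau, q)) d.
Proof.
have coord_cts i : continuous (fun tau => g (tau, q) 0 i).
  rewrite (_ : (fun _ => _) = (fun tau => dot (g (tau, q)) (delta_mx 0 i))).
    exact: (continuous_slice _ q (g_cts _)).
  by apply/funext => tau; exact: coord_dot.
have sum_cts r : continuous (fun tau => \sum_(i <- r) g (tau, q) 0 i * d 0 i).
  elim: r => [|i r IH] tau.
    by under eq_fun do rewrite big_nil; exact: cvg_cst.
  under eq_fun do rewrite big_cons; apply: cvgD; last exact: IH.
  by apply: cvgM; [exact: coord_cts|exact: cvg_cst].
rewrite /dot; elim: (index_enum _) => [|i r IH].
  rewrite big_nil (_ : (fun _ => _) = cst 0) ?Rintegral_cst ?mul0r//.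
  by apply/funext => tau; rewrite big_nil.
rewrite big_cons IH mxE -RintegralZr//; last exact: continuous_integrable.
rewrite -RintegralD//; last exact: continuous_integrable.
  by apply: eq_Rintegral => tau _; rewrite big_cons.
by apply: continuous_integrable => tau; apply: cvgM; [exact: coord_cts|exact: cvg_cst].
Qed.

Lemma continuous_action t : 0 <= t -> continuous (action t).
Proof.
move=> t0 q; apply/(@cvgrPdist_le R R^o _ (nbhs q) _ (action t) (action t q)) => e e0.
have t1 : 0 < t + 1 by rewrite ltr_wpDl.
have [eta eta0 tube] := continuous_tube F 0 t q (e / (t + 1)) F_cts (divr_gt0 e0 t1).
apply/nbhs_ballP; exists eta => //= q'; rewrite -ball_normE /= distrC => qq'.
rewrite /action distrC -RintegralB//;
  [|exact: continuous_integrable (continuous_slice _ _ F_cts)..].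
apply: le_trans (norm_Rintegral_segment_le _ 0 t (e / (t + 1)) _ t0 _) _.
- by move=> tau; apply: cvgB; exact: continuous_slice F_cts _.
- by move=> tau tau_t; exact: tube.
- rewrite subr0 mulrAC ler_pdivrMr// ler_wpM2l ?ltW// ltrDl//.
Qed.

Lemma actionB s t q : 0 <= s <= t ->
  action t q - action s q = \int[mu]_(tau in `[s, t]) F (tau, q).
Proof. by move=> st; rewrite /action Rintegral_segmentB//; exact: continuous_slice. Qed.

Lemma action_lipschitz_time (T L : R) : 0 <= T -> 0 <= L -> exists2 C, 0 <= C &
  forall s t q, 0 <= s <= T -> 0 <= t <= T -> `|q| <= L ->
    `|action t q - action s q| <= C * `|t - s|.
Proof.
move=> T0 L0; have [C C0 FC] := compact_cylinder_bound F T L T0 L0 F_cts.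
exists C => // s t q.
wlog st : s t / s <= t => [hw sT tT qL|].
  by case: (leP s t) => [st|/ltW ts]; [|rewrite distrC (distrC t)]; exact: hw.
move=> /andP[s0 sT] /andP[t0 tT] qL.
rewrite actionB ?s0// (ger0_norm (x := t - s)) ?subr_ge0//.
apply: norm_Rintegral_segment_le => //; first exact: continuous_slice.
by move=> tau /andP[stau taut]; apply: FC => //; rewrite (le_trans s0)// (le_trans taut).
Qed.

Lemma action_grad_lipschitz_time (T L : R) : 0 <= T -> 0 <= L -> exists2 C, 0 <= C &
  forall s t q, 0 <= s <= t -> t <= T -> `|q| <= L ->
    enorm (action_grad t q - action_grad s q) <= C * (t - s).
Proof.
move=> T0 L0.
have /choice[C CP] : forall i : 'I_n, exists C, 0 <= C /\
    forall t q, 0 <= t <= T -> `|q| <= L -> `|dot (g (t, q)) (delta_mx 0 i)| <= C.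
  move=> i; have [C C0 gC] := compact_cylinder_bound _ T L T0 L0 (g_cts (delta_mx 0 i)).
  by exists C.
pose M := \sum_i C i.
have CM i : C i <= M.
  by rewrite /M (bigD1 i)//= lerDl; apply: sumr_ge0 => j _; exact: (CP j).1.
exists (n%:R * M); first by rewrite mulr_ge0// sumr_ge0// => i _; exact: (CP i).1.
move=> s t q /andP[s0 st] tT qL; rewrite -mulrA; apply: enorm_le => i.
rewrite coord_dot dotDl dotNl !dot_action_grad Rintegral_segmentB ?s0//; last first.
  exact: (continuous_slice _ q (g_cts _)).
apply: norm_Rintegral_segment_le => //; first exact: (continuous_slice _ q (g_cts _)).
move=> tau /andP[stau taut]; apply: le_trans (CM i); apply: (CP i).2 => //.
by rewrite (le_trans s0)// (le_trans taut).
Qed.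

(** The increment is an integral of [F] over times between [t0] and [t], where [F (tau, q)] is
    within [e] of [F (t0, q0)]. *)
Lemma action_expansion_time t0 q0 (e : R) : 0 < t0 -> 0 < e ->
  exists2 eta, 0 < eta & forall t q, `|t - t0| < eta -> `|q - q0| < eta ->
    `|action t q - action t0 q - (t - t0) * F (t0, q0)| <= e * `|t - t0|.
Proof.
move=> t0_gt0 e0; have /cvgrPdist_lt/(_ _ e0) := F_cts (t0, q0).
move=> /nbhs_ballP[r /= r0 near_r].
(* A radius at most [t0] keeps [t] nonnegative, so that the increment is an integral over a segment
   of nonnegative times. *)
exists (Num.min r t0); first by rewrite lt_min r0.
move=> t q; rewrite lt_min => /andP[tr tt0]; rewrite lt_min => /andP[qr _].
have F_near tau : `|tau - t0| <= `|t - t0| -> `|F (tau, q) - F (t0, q0)| <= e.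
  move=> tau_t; rewrite distrC ltW//; apply: near_r; split.
    by rewrite -ball_normE /= distrC (le_lt_trans tau_t).
  by rewrite -ball_normE /= distrC.
have cFq : continuous (fun tau => F (tau, q) - F (t0, q0)).
  by move=> tau; apply: cvgB; [exact: continuous_slice|exact: cvg_cst].
have increment a b : 0 <= a <= b -> action b q - action a q - (b - a) * F (t0, q0) =
    \int[mu]_(tau in `[a, b]) (F (tau, q) - F (t0, q0)).
  move=> /[dup] ab /andP[_ ab']; rewrite actionB// RintegralB//.
  - by rewrite Rintegral_segment_cst// mulrC.
  - exact: continuous_integrable (continuous_slice _ _ F_cts).
  - by apply: continuous_integrable => tau; exact: cvg_cst.
have t_ge0 : 0 <= t by move: tt0; rewrite ltr_norml; lra.
have [t0t|tt0'] := leP t0 t.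
  rewrite increment ?t0t ?(ltW t0_gt0)// (ger0_norm (x := t - t0)) ?subr_ge0//.
  apply: norm_Rintegral_segment_le => // tau /andP[? ?]; apply: F_near.
  by rewrite !ger0_norm; lra.
rewrite -normrN; have -> : - (action t q - action t0 q - (t - t0) * F (t0, q0)) =
  action t0 q - action t q - (t0 - t) * F (t0, q0) by ring.
rewrite increment ?t_ge0 ?(ltW tt0')// (distrC t).
rewrite (ger0_norm (x := t0 - t)) ?subr_ge0 ?(ltW tt0')//.
apply: norm_Rintegral_segment_le => //; first exact: ltW.
move=> tau /andP[? ?]; apply: F_near.
by rewrite !ler0_norm; lra.
Qed.

(** Differentiation under the integral: the mean value theorem gives the increment of each time
    slice as [s] times a derivative at an intermediate slope, and the tube estimate makes the error
    uniform in [tau]. *)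
Lemma action_is_grad t q : 0 <= t -> is_grad (action t) q (action_grad t q).
Proof.
move=> t_ge0 d e e0.
have t1 : 0 < t + 1 by rewrite ltr_wpDl.
pose e1 := e / (t + 1); have e10 : 0 < e1 by exact: divr_gt0.
have [eta eta0 tube] := continuous_tube _ 0 t q e1 (g_cts d) e10.
have d1 : 0 < `|d| + 1 by rewrite ltr_wpDl.
exists (eta / (`|d| + 1)); first exact: divr_gt0.
move=> s /andP[s0]; rewrite ltr_pdivlMr// => s_eta.
have slice_eq tau : 0 <= tau <= t ->
    `|F (tau, q + s *: d) - F (tau, q) - s * dot (g (tau, q)) d| <= s * e1.
  move=> tau_t; pose f r := F (tau, q + r *: d).
  have f_der (r : R) : is_derive r (1 : R) f (dot (g (tau, q + r *: d)) d).
    apply: expansion_is_derive => e' e'0.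
    have [s1 s10 h] := F_exp tau (q + r *: d) d e' e'0.
    by exists s1 => // k /h; rewrite /f scalerDl addrA.
  have f_cts : {within `[0, s], continuous f}.
    apply: continuous_subspaceT => r; apply: differentiable_continuous.
    exact/derivable1_diffP.
  have [r] := MVT s0 (fun r _ => f_der r) f_cts.
  rewrite in_itv/= subr0 => /andP[r0 rs]; rewrite /f scale0r addr0 => ->.
  rewrite mulrC -mulrBr normrM gtr0_norm// ler_pM2l//; apply: tube => //.
  rewrite addrAC subrr add0r normrZ gtr0_norm//.
  by have := normr_ge0 d; nra.
rewrite dot_action_grad /action.
have c1 q' : continuous (fun tau => F (tau, q')) by exact: continuous_slice.
have c2 : continuous (fun tau => dot (g (tau, q)) d).
  exact: (continuous_slice _ q (g_cts d)).
rewrite -RintegralB//; [|exact: continuous_integrable..].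
rewrite -RintegralZl//; last exact: continuous_integrable.
rewrite -RintegralB//; last first.
- by apply: continuous_integrable => tau; apply: cvgM; [exact: cvg_cst|exact: c2].
- by apply: continuous_integrable => tau; apply: cvgB; exact: c1.
apply: le_trans (norm_Rintegral_segment_le _ 0 t (s * e1) _ t_ge0 slice_eq) _.
  move=> tau; apply: cvgB; last by apply: cvgM; [exact: cvg_cst|exact: c2].
  by apply: cvgB; exact: c1.
rewrite subr0 -mulrA ler_pM2l// mulrAC ler_pdivrMr// ler_wpM2l ?ltW//.
by rewrite ltrDl.
Qed.

End Action.

(** * Convexity along segments and spatial parts of differentials *)

Lemma dot_additive_homogeneous {R : realType} {n : nat} (f : 'rV[R]_n -> R) x :
  (forall x y, f (x + y) = f x + f y) -> (forall k x, f (k *: x) = k * f x) ->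
  f x = dot x (\row_i f (delta_mx 0 i)).
Proof.
move=> fD fZ; have f0 : f 0 = 0 by rewrite -(scale0r 0) fZ mul0r.
rewrite {1}(row_sum_delta x) (big_morph f fD f0).
by apply: eq_bigr => i _; rewrite fZ mxE.
Qed.

Lemma convex_function_segment {R : realType} {V : lmodType R} (f : V -> R) :
  convex_function setT f -> forall x y s, 0 <= s <= 1 ->
  f (x + s *: (y - x)) <= f x + s * (f y - f x).
Proof.
move=> f_cvx x y s /andP[s0 s1].
have inT (z : convex_lmodType V) : z \in [set: convex_lmodType V] by rewrite inE.
have h := f_cvx (Itv01 s0 s1) y x (inT y) (inT x).
apply: le_trans (_ : _ <= s * f y + (1 - s) * f x) _.
  apply: le_trans h; rewrite (_ : x + _ = s *: y + (1 - s) *: x)//.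
  by rewrite scalerBr scalerBl scale1r addrCA.
by lra.
Qed.

Section SpacetimeDifferential.
Context {R : realType} {n : nat}.
Implicit Types (x q d : 'rV[R]_n) (f : R * 'rV[R]_n -> R).

Definition spatial_row (df : R * 'rV[R]_n -> R) : 'rV[R]_n :=
  \row_i df (0, delta_mx 0 i).

Lemma spatial_rowE (df : {linear (R * 'rV[R]_n)%type -> R}) d :
  df (0, d) = dot (spatial_row df) d.
Proof.
rewrite dotC (dot_additive_homogeneous (fun d => df (0, d)))//.
- by move=> x y; rewrite -linearD/=; congr (df (_, _)); rewrite addr0.
- move=> k x; have -> : (0, k *: x) = k *: (0, x) :> R * 'rV[R]_n.
    by congr (_, _); rewrite scaler0.
  by rewrite linearZ.
Qed.

(** Yields the continuity of the linear maps in [C1_on], through the explicit form. *)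
Lemma spacetime_linear_form (df : {linear (R * 'rV[R]_n)%type -> R}) z :
  df z = spacetime_form (- df (1, 0)) (spatial_row df) z.
Proof.
have -> : df z = df (z.1 *: (1, 0) + (0, z.2)).
  congr (df _); case: z => t x /=; congr (_, _) => /=.
    by rewrite addr0 /GRing.scale/= mulr1.
  by rewrite scaler0 add0r.
by rewrite linearD linearZ/= spatial_rowE /spacetime_form dotC mulrN opprK addrC.
Qed.

Lemma expansion_spatial (A : set (R * 'rV[R]_n)) f t q d
    (df : {linear (R * 'rV[R]_n)%type -> R}) : (forall x, A (t, x)) ->
  (forall e : R, 0 < e -> \forall w \near within A (nbhs (t, q)),
    `|f w - f (t, q) - df (w - (t, q))| <= e * `|w - (t, q)|) ->
  forall e : R, 0 < e -> exists2 s0 : R, 0 < s0 & forall s, `|s| < s0 ->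
    `|f (t, q + s *: d) - f (t, q) - s * dot (spatial_row df) d| <= `|s| * e.
Proof.
move=> At f_exp e e0.
have tqs (s : R) : (t, q) + s *: (0, d) = (t, q + s *: d) :> R * 'rV[R]_n.
  by congr (_, _) => /=; rewrite scaler0 addr0.
have [|s0 s00 h] := @expansion_dir R _ A f (t, q) (0, d) df _ f_exp e e0.
  by move=> s; rewrite tqs.
by exists s0 => // s /h; rewrite tqs spatial_rowE.
Qed.

Lemma differentiable_is_grad f t x : differentiable f (t, x) ->
  is_grad (fun y => f (t, y)) x (spatial_row ('d f (t, x))).
Proof.
move=> df d e e0.
have [|s0 s00 h] := @expansion_spatial setT f t x d ('d f (t, x)) (fun=> I) _ e e0.
  move=> e' e'0; apply: filter_app (differentiable_expansion _ _ _ _ df e' e'0).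
  by near=> w => h _.
exists s0 => // s /andP[s_gt0 ss0].
by have := h s; rewrite gtr0_norm//; apply.
Unshelve. all: by end_near. Qed.

Lemma C1_on_is_grad (f : 'rV[R]_n -> R) : C1_on setT f ->
  exists df, forall x, is_grad f x (df x).
Proof.
move=> [df [f_exp _]]; exists (fun x => \row_i df x (delta_mx 0 i)) => x d e e0.
have [|s0 s00 h] := @expansion_dir R _ setT f x d (df x) (fun=> I) _ e e0.
  exact: f_exp.
exists s0 => // s /andP[s_gt0 ss0].
by have := h s; rewrite gtr0_norm// dotC -dot_linear; apply.
Qed.

End SpacetimeDifferential.

(** * Extension of the Hamiltonian to all times *)

Section Clamp.
Context {R : realType} {n : nat} {T : R}.
Hypothesis T_ge0 : 0 <= T.

(* Composing with [clamp] in time turns functions continuous within [0, T] into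
   functions continuous everywhere. *)
Definition clamp (t : R) : R := Num.max 0 (Num.min t T).

Lemma clamp_in t : 0 <= clamp t <= T.
Proof. by rewrite /clamp le_max lexx ge_max T_ge0 ge_min lexx orbT. Qed.

Lemma clamp_id t : 0 <= t <= T -> clamp t = t.
Proof. by move=> /andP[t0 tT]; rewrite /clamp (min_idPl tT) (max_idPr t0). Qed.

Lemma continuous_clamp : continuous clamp.
Proof.
move=> t; apply: (@continuous_max _ _ (fun=> 0) (fun t => Num.min t T)).
  exact: cvg_cst.
by apply: (@continuous_min _ _ id (fun=> T)); [exact: cvg_id|exact: cvg_cst].
Qed.

Local Notation A := [set z : R * 'rV[R]_n | 0 <= z.1 <= T].

Lemma continuous_clamp_extension (f : R * 'rV[R]_n -> R) :
  {within A, continuous f} -> continuous (fun z => f (clamp z.1, z.2)).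
Proof.
move=> /subspace_continuousP cf z.
have Az : A (clamp z.1, z.2) by exact: clamp_in.
have cc : {for z, continuous (fun z : R * 'rV[R]_n => (clamp z.1, z.2))}.
  apply: (@cvg_pair _ _ _ (nbhs z) (nbhs (clamp z.1)) (nbhs z.2)).
    apply: (@continuous_comp _ _ _ fst clamp); [exact: cvg_fst|exact: continuous_clamp].
  exact: cvg_snd.
move=> U /(cf _ Az) fU.
have {fU} fU : nbhs (clamp z.1, z.2) (fun w => A w -> U (f w)) by exact: fU.
have {fU} fU : nbhs z (fun w => A (clamp w.1, w.2) -> U (f (clamp w.1, w.2))).
  exact: cc fU.
by apply: (@filterS _ (nbhs z) _ _ _ _ fU) => w; apply; exact: clamp_in.
Qed.

(** Freezing the Hamiltonian at its end values outside [0, T] preserves continuity and the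
    derivatives in space, which is what the study of the action requires. *)
Lemma C1_on_extension (H : R -> 'rV[R]_n -> R) : C1_on A (fun z => H z.1 z.2) ->
  exists (F : R * 'rV[R]_n -> R) (g : R * 'rV[R]_n -> 'rV[R]_n),
  [/\ continuous F, (forall d, continuous (fun z => dot (g z) d)),
    (forall t q d (e : R), 0 < e ->
      exists2 s0 : R, 0 < s0 & forall s, `|s| < s0 ->
      `|F (t, q + s *: d) - F (t, q) - s * dot (g (t, q)) d| <= `|s| * e) &
    forall t q, 0 <= t <= T -> F (t, q) = H t q].
Proof.
move=> [dH [H_exp dH_cts]].
exists (fun z => H (clamp z.1) z.2), (fun z => spatial_row (dH (clamp z.1, z.2))).
split.
- apply: (continuous_clamp_extension (fun z => H z.1 z.2)).
  apply/subspace_continuousP => z Az; apply/cvgrPdist_le => e e0.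
  (* Continuity comes from the expansion with constant 1: the increment is at most
     [|dH z (w - z)| + |w - z|], and each term is at most [e / 2] near [z]. *)
  have e20 : 0 < e / 2 by rewrite divr_gt0.
  have near1 : \forall w \near within A (nbhs z), `|w - z| <= e / 2.
    apply: cvg_within; apply/nbhs_ballP; exists (e / 2) => //= w.
    by rewrite -ball_normE /= distrC => /ltW.
  have near2 : \forall w \near within A (nbhs z), `|dH z (w - z)| <= e / 2.
    apply: cvg_within.
    have cform := @continuous_spacetime_form R n (- dH z (1, 0)) (spatial_row (dH z)) 0.
    have /cvgrPdist_le/(_ _ e20) := cform.
    rewrite [X in X -> _](near_shift z 0); apply: filterS => w /=.
    by rewrite sub0r -spacetime_linear_form -spacetime_linear_form linear0 sub0r normrN.
  apply: filterS3 near1 near2 (H_exp z Az 1 ltr01) => w h1 h2 h3.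
  rewrite distrC -(subrK (dH z (w - z)) (_ - _)) (le_trans (ler_normD _ _))//.
  by rewrite mul1r in h3; lra.
- move=> d; rewrite (_ : (fun _ => _) =
      (fun z : R * 'rV[R]_n => dH (clamp z.1, z.2) (0, d))).
    exact: (continuous_clamp_extension (fun z => dH z (0, d))).
  by apply/funext => z; rewrite spatial_rowE.
- move=> t q d e e0 /=.
  apply: (@expansion_spatial _ _ A (fun z => H z.1 z.2) (clamp t) q d) => // [x|].
    exact: clamp_in.
  by move=> e' e'0; apply: H_exp => //; exact: clamp_in.
- by move=> t q tT /=; rewrite clamp_id.
Qed.

End Clamp.

(** * Consequences of (A2) for the action *)

Section Structure.
Context {R : realType} {n : nat}.
Local Notation mu := (@lebesgue_measure R).

(** The left endpoint has measure zero; it is excluded because the convexity and sign conditions of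
    (A2) are imposed only for positive times. *)
Lemma le_Rintegral_segment (f g : R -> R) (a b : R) :
  continuous f -> continuous g -> (forall t, a < t <= b -> f t <= g t) ->
  \int[mu]_(t in `[a, b]) f t <= \int[mu]_(t in `[a, b]) g t.
Proof.
move=> cf cg fg.
have oc k : continuous k -> mu.-integrable `]a, b] (EFin \o k).
  move=> ck; apply: (@integrableS _ _ _ mu `[a, b]) => //.
    exact: subset_itv_oc_cc.
  exact: continuous_integrable.
rewrite -(Rintegral_itv_obnd_cbnd (oc f cf)) -(Rintegral_itv_obnd_cbnd (oc g cg)).
exact: (le_Rintegral _ (oc f cf) (oc g cg)).
Qed.

Variables (T : R) (H : R -> 'rV[R]_n -> R) (F : R * 'rV[R]_n -> R).
Hypothesis F_cts : continuous F.
Hypothesis F_eq : forall t q, 0 <= t <= T -> F (t, q) = H t q.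

Let slice_cts q : continuous (fun t => F (t, q)) := continuous_slice F q F_cts.

Lemma Rintegral_segment_affine (f g : R -> R) (a b s : R) :
  continuous f -> continuous g ->
  \int[mu]_(t in `[a, b]) (f t + s * (g t - f t)) =
  \int[mu]_(t in `[a, b]) f t +
  s * (\int[mu]_(t in `[a, b]) g t - \int[mu]_(t in `[a, b]) f t).
Proof.
move=> cf cg.
have cgf : continuous (fun t => g t - f t).
  by move=> t; apply: cvgB; [exact: cg|exact: cf].
rewrite RintegralD//; last 2 first.
- exact: continuous_integrable.
- by apply: continuous_integrable => t; apply: cvgM; [exact: cvg_cst|exact: cgf].
rewrite RintegralZl//; last exact: continuous_integrable.
by rewrite RintegralB//; exact: continuous_integrable.
Qed.

Let affine_cts p q (s : R) :
  continuous (fun t => F (t, p) + s * (F (t, q) - F (t, p))).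
Proof.
move=> t; apply: cvgD; first exact: slice_cts.
apply: cvgM; first exact: cvg_cst.
by apply: cvgB; exact: slice_cts.
Qed.

Lemma action_convex t : t < T ->
  (forall tau, 0 < tau < T -> convex_function setT (H tau)) ->
  forall p q s, 0 <= s <= 1 ->
  action F t (p + s *: (q - p)) <= action F t p + s * (action F t q - action F t p).
Proof.
move=> tT H_cvx p q s s01; rewrite /action -Rintegral_segment_affine//.
apply: le_Rintegral_segment => // tau /andP[tau0 taut].
rewrite !F_eq; try by apply/andP; split; lra.
by apply: (convex_function_segment _ (H_cvx tau _)) => //; apply/andP; split; lra.
Qed.

Lemma action_increment_concave s t : 0 <= s <= t -> t < T ->
  (forall tau, 0 < tau < T -> convex_function setT (fun p => - H tau p)) ->
  forall p q r, 0 <= r <= 1 ->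
  (action F t \- action F s) p +
    r * ((action F t \- action F s) q - (action F t \- action F s) p) <=
  (action F t \- action F s) (p + r *: (q - p)).
Proof.
move=> st tT H_ccv p q r r01.
have incE x : (action F t \- action F s) x = \int[mu]_(tau in `[s, t]) F (tau, x).
  exact: actionB.
rewrite !incE -Rintegral_segment_affine//.
apply: le_Rintegral_segment => // tau /andP[stau taut].
move: st => /andP[s0 st]; rewrite !F_eq; try by apply/andP; split; lra.
have tauT : 0 < tau < T by apply/andP; split; lra.
by have := convex_function_segment _ (H_ccv tau tauT) p q r r01; rewrite /=; lra.
Qed.

(** In case b) the action at time r is rho(q) [Delta r] plus a term free of q, with [Delta]
    nonnegative and nondecreasing because g keeps its sign. If [Delta s = 0] the action at [s] is
    constant in q; if [Delta s = Delta t] the increment is; otherwise theta is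
    [Delta s / Delta t]. *)
Lemma action_trichotomy s t : A2 T H -> 0 < s <= t -> t < T ->
  [\/ forall p q r, 0 <= r <= 1 ->
        action F s (p + r *: (q - p)) <= action F s p + r * (action F s q - action F s p),
      forall p q r, 0 <= r <= 1 ->
        (action F t \- action F s) p +
          r * ((action F t \- action F s) q - (action F t \- action F s) p) <=
        (action F t \- action F s) (p + r *: (q - p)) |
      exists theta c, 0 < theta < 1 /\ forall q, action F s q = theta * action F t q + c].
Proof.
move=> hA2 /andP[s0 st] tT; have s_ge0 := ltW s0.
have s_t : 0 <= s <= t by rewrite s_ge0.
have sT : s < T by exact: le_lt_trans tT.
have [[cvx|ccv]|[g [h [k [Hghk g_sign]]]]] := hA2.
- by apply: Or31; exact: action_convex.
- by apply: Or32; exact: action_increment_concave.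
have FB tau p q : 0 <= tau <= T -> F (tau, p) - F (tau, q) = g tau * (h p - h q).
  by move=> tauT; rewrite !F_eq// !Hghk//; ring.
have const_convex c : (forall q, action F s q = c) ->
    forall p q r, 0 <= r <= 1 ->
    action F s (p + r *: (q - p)) <= action F s p + r * (action F s q - action F s p).
  by move=> sc p q r _; rewrite !sc subrr mulr0 addr0.
have [h_const|h_nonconst] := pselect (forall p q, h p = h q).
  apply: Or31; apply: (const_convex (action F s 0)) => q.
  apply: eq_Rintegral => tau; rewrite inE/= in_itv/= => /andP[tau0 taus].
  have tauT : 0 <= tau <= T by apply/andP; split; lra.
  by apply/subr0_eq; rewrite FB// (h_const q 0) subrr mulr0.
(* The order of [p1] and [p2] absorbs the sign of [g]. *)
have [p1 [p2 [h12 D_ge0]]] : exists p1 p2, h p1 != h p2 /\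
    forall tau, 0 < tau < T -> 0 <= F (tau, p1) - F (tau, p2).
  move/existsNP: h_nonconst => [p /existsNP[q /eqP hpq]].
  have FB' tau a b : 0 < tau < T -> F (tau, a) - F (tau, b) = g tau * (h a - h b).
    by move=> /andP[? ?]; apply: FB; rewrite !ltW.
  wlog h_lt : p q hpq / h q < h p.
    move=> hw; have [lt|gt|eq] := ltgtP (h q) (h p); first exact: (hw p q).
      by apply: (hw q p) => //; rewrite eq_sym.
    by rewrite eq eqxx in hpq.
  case: g_sign => g_sign; [exists p, q|exists q, p].
    by split=> // tau tauT; rewrite FB'// mulr_ge0 ?g_sign// subr_ge0 ltW.
  split=> [|tau tauT]; first by rewrite eq_sym.
  by rewrite FB'// mulr_le0 ?g_sign// subr_le0 ltW.
have D_cts : continuous (fun tau => F (tau, p1) - F (tau, p2)).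
  by move=> tau; apply: cvgB; exact: slice_cts.
(* H(t, q) = H(t, p2) + rho(q) (H(t, p1) - H(t, p2)) with rho independent of t,
   so neither g nor k needs to be integrable. *)
pose Delta r := action F r p1 - action F r p2.
have DeltaE r : Delta r = \int[mu]_(tau in `[0, r]) (F (tau, p1) - F (tau, p2)).
  by rewrite /Delta /action -RintegralB//; exact: continuous_integrable.
have actionE r q : 0 <= r <= t ->
    action F r q = (h q - h p2) / (h p1 - h p2) * Delta r + action F r p2.
  move=> /andP[r0 rt]; apply/eqP; rewrite -subr_eq; apply/eqP.
  rewrite DeltaE -RintegralZl//; last exact: continuous_integrable.
  rewrite /action -RintegralB//; [|exact: continuous_integrable..].
  apply: eq_Rintegral => tau; rewrite inE/= in_itv/= => /andP[tau0 taur].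
  have tauT : 0 <= tau <= T by apply/andP; split; lra.
  by rewrite !FB// mulrCA divfK// subr_eq0.
have zero_le (a b : R) : 0 <= a -> b < T ->
    0 <= \int[mu]_(tau in `[a, b]) (F (tau, p1) - F (tau, p2)).
  move=> a0 bT; have <- : \int[mu]_(tau in `[a, b]) (0 : R) = 0.
    by rewrite Rintegral_cst// mul0r.
  apply: le_Rintegral_segment => //; first by move=> tau; exact: cvg_cst.
  by move=> tau /andP[atau taub]; apply: D_ge0; apply/andP; split; lra.
have Delta_s : 0 <= Delta s by rewrite DeltaE zero_le.
have Delta_st : Delta s <= Delta t.
  by rewrite -subr_ge0 !DeltaE Rintegral_segmentB// zero_le.
have tt : 0 <= t <= t by rewrite lexx andbT (le_trans s_ge0).
have [Ds0|Ds_neq] := eqVneq (Delta s) 0.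
  apply: Or31; apply: (const_convex (action F s p2)) => q.
  by rewrite actionE// Ds0 mulr0 add0r.
have [Dst|Dst_neq] := eqVneq (Delta s) (Delta t).
  apply: Or32 => p q r _.
  have const_inc x : (action F t \- action F s) x = action F t p2 - action F s p2.
    by rewrite /= (actionE t)// (actionE s)// Dst; ring.
  by rewrite !const_inc subrr mulr0 addr0.
have Ds_gt0 : 0 < Delta s by rewrite lt_neqAle eq_sym Ds_neq.
have Dst_lt : Delta s < Delta t by rewrite lt_neqAle Dst_neq.
have Dt_gt0 : 0 < Delta t by exact: lt_trans Dst_lt.
apply: Or33; exists (Delta s / Delta t).
exists (action F s p2 - Delta s / Delta t * action F t p2).
split=> [|q]; first by rewrite divr_gt0//= ltr_pdivrMr// mul1r.
rewrite (actionE s)// (actionE t)//; field; apply/andP; split.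
  by rewrite gt_eqF.
by rewrite subr_eq0.
Qed.

End Structure.

(** * From the Hopf formula to epigraph maximizers, and propagation of singularities *)

(** Slopes with infinite conjugate contribute -oo, and the others give epigraph points. At a
    maximizer the height [w.2] equals the conjugate, since lowering it would increase the gain. *)
Lemma hopf_eq_gain {R : realType} {n : nat} (H : R -> 'rV[R]_n -> R)
    (sigma B : 'rV[R]_n -> R) (t : R) (x : 'rV[R]_n) (w : 'rV[R]_n * R) :
  (forall q, (\int[lebesgue_measure]_(tau in `[0%R, t]) H tau q)%R = B q) ->
  is_maximizer (sigma := sigma) B x w -> hopf H sigma (t, x) = gain B x w.
Proof.
move=> HB [w_epi w_max].
have fenchel_le q r : conj_epi sigma (q, r) -> (fenchel sigma q <= r%:E)%E.
  by move=> qr; apply: ge_ereal_sup => _ [y _ <-]; rewrite lee_fin; exact: qr.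
have fenchel_epi q r : fenchel sigma q = r%:E -> conj_epi sigma (q, r).
  move=> qr y; rewrite /= -lee_fin -qr; apply: ereal_sup_ubound.
  by exists y.
have fenchel_gtNy q : (-oo < fenchel sigma q)%E.
  apply: (@lt_le_trans _ _ ((dot 0 q - sigma 0)%:E)); first exact: ltNyr.
  by apply: ereal_sup_ubound; exists 0.
have arg_le q : (hopf_arg H sigma t x q <= (gain B x w)%:E)%E.
  rewrite /hopf_arg HB; case E : (fenchel sigma q) => [r| |].
  - rewrite -!EFinB lee_fin; exact: (w_max (q, r) (fenchel_epi q r E)).
  - by rewrite leNye.
  - by have := fenchel_gtNy q; rewrite E ltxx.
have arg_w : hopf_arg H sigma t x w.1 = (gain B x w)%:E.
  have wE : fenchel sigma w.1 = w.2%:E.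
    have := fenchel_le w.1 w.2; rewrite -surjective_pairing => /(_ w_epi).
    case E : (fenchel sigma w.1) => [r| |] //.
      rewrite lee_fin => rw; congr (_%:E); apply/le_anti; rewrite rw/=.
      by have := w_max _ (fenchel_epi _ _ E); rewrite /gain/=; lra.
    by have := fenchel_gtNy w.1; rewrite E ltxx.
  by rewrite /hopf_arg HB wE -!EFinB.
rewrite /hopf /emax /= (@xget_unique _ _ _ (gain B x w)%:E)//.
  split; first by exists w.1.
  by move=> _ [q _ <-]; exact: arg_le.
move=> m [[q _ <-] m_ub]; apply/le_anti; rewrite arg_le/=.
by apply: m_ub; exists w.1.
Qed.

Theorem theorem3p6 (R : realType) (n : nat) (T : R)
    (H : R -> 'rV[R]_n -> R) (sigma : 'rV[R]_n -> R)
    (T_gt0 : 0 < T)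
    (H_C1 : C1_on [set z : R * 'rV[R]_n | 0 <= z.1 <= T] (fun z => H z.1 z.2))
    (sigma_convex : convex_function setT sigma)
    (sigma_C1 : C1_on setT sigma)
    (hA1 : A1 T H sigma)
    (hA2 : A2 T H)
    (sigma_lipschitz : [lipschitz sigma x | x in setT]) :
  forall eps : R, 0 < eps ->
  exists delta : R, 0 < delta /\
    forall (t0 : R) (x0 : 'rV[R]_n), singular T (hopf H sigma) (t0, x0) ->
    forall t1 : R, t0 <= t1 <= t0 + delta -> t1 < T ->
    exists x1 : 'rV[R]_n, enorm (x1 - x0) <= eps /\
      singular T (hopf H sigma) (t1, x1).
Proof.
move=> eps eps0; have T_ge0 := ltW T_gt0.
have [L /ltW L_ge0 sigma_lip'] := pinfty_ex_gt0 sigma_lipschitz.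
have sigma_lip x y : `|sigma x - sigma y| <= L * `|x - y|.
  exact: (sigma_lip' (x, y) (conj I I)).
have sigma_cvx := convex_function_segment sigma sigma_convex.
have [dsigma dsigma_grad] := C1_on_is_grad sigma sigma_C1.
have [F [g [F_cts g_cts F_exp F_eq]]] := C1_on_extension T_ge0 H H_C1.
have [C C_ge0 grad_lip] := action_grad_lipschitz_time g g_cts T L T_ge0 L_ge0.
have [D D_ge0 action_lip] := action_lipschitz_time F F_cts T L T_ge0 L_ge0.
have C1_gt0 : 0 < C + 1 by rewrite ltr_wpDl.
have value t x : 0 <= t <= T -> exists2 w,
    is_maximizer (sigma := sigma) (action F t) x w &
    hopf H sigma (t, x) = gain (action F t) x w.
  move=> /andP[t0 tT].
  have [|w w_max] := maximizer_exists L_ge0 sigma_lip (action F t) x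
    (continuous_action F F_cts t t0).
    by exists (dsigma 0, dot 0 (dsigma 0) - sigma 0); exact: conj_epi_grad.
  exists w => //; apply: hopf_eq_gain w_max => q.
  apply: eq_Rintegral => tau; rewrite inE/= in_itv/= => /andP[tau0 taut].
  by rewrite F_eq// tau0 (le_trans taut).
(* [C] bounds the speed of every characteristic with [|q| <= L], uniformly in time, so none moves
   farther than [eps] within this delay; [+ 1] covers [C = 0]. *)
exists (eps / (C + 1)); split; first exact: divr_gt0.
move=> t0 x0 [/= /andP[t0_gt0 t0T] not_diff] t1 /andP[t01 t1delta] t1T.
have t0_ge0 := ltW t0_gt0; have t1_ge0 : 0 <= t1 by exact: le_trans t01.
(* Without singular points in the ball at time [t1], the maximizer at [(t0, x0)] is shown to be
   unique, which contradicts singularity there. *)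
apply: contrapT => /forallNP no_singular; apply: not_diff.
have t1_diff x : enorm (x - x0) <= eps -> differentiable (hopf H sigma) (t1, x).
  move=> x_near; apply: contrapT => x_sing; apply: (no_singular x).
  by split=> //; split=> //=; rewrite t1T (lt_le_trans t0_gt0).
have A0_grad q := action_is_grad F g F_cts g_cts F_exp t0 q t0_ge0.
have A1_grad q := action_is_grad F g F_cts g_cts F_exp t1 q t1_ge0.
have grad_close q : `|q| <= L ->
    enorm (action_grad g t1 q - action_grad g t0 q) <= eps.
  move=> qL; have t01' : 0 <= t0 <= t1 by rewrite t0_ge0.
  apply: le_trans (grad_lip _ _ _ t01' (ltW t1T) qL) _.
  have : (t1 - t0) * (C + 1) <= eps by rewrite -ler_pdivlMr//; lra.
  by nra.
have phi_value x : exists2 w, is_maximizer (sigma := sigma) (action F t1) x w &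
    hopf H sigma (t1, x) = gain (action F t1) x w.
  by apply: value; rewrite t1_ge0 ltW.
have phi_diff x : enorm (x - x0) <= eps ->
    exists a, is_grad (fun y => hopf H sigma (t1, y)) x a.
  move=> /t1_diff/differentiable_is_grad dphi.
  by exists (spatial_row ('d (hopf H sigma) (t1, x))).
have uniq : at_most_one_maximizer (sigma := sigma) (action F t0) x0.
  have t01' : 0 < t0 <= t1 by rewrite t0_gt0.
  have [cvx|ccv|[theta [c [theta01 prop]]]] :=
      action_trichotomy T H F F_cts F_eq t0 t1 hA2 t01' t1T.
  - apply: (maximizer_unique_convex sigma_cvx dsigma dsigma_grad _
      (action_grad g t0)) => // p q.
    by apply: cvx; apply/andP; split; lra.
  - apply: (maximizer_unique_concave L_ge0 sigma_lip (action F t0) (action F t1)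
      (action_grad g t0) (action_grad g t1) A0_grad A1_grad x0 eps (ltW eps0)
      grad_close (fun y => hopf H sigma (t1, y)) phi_value phi_diff ccv).
    by move=> q; apply: continuousB; exact: continuous_action.
  - exact: (maximizer_unique_proportional L_ge0 sigma_lip sigma_cvx dsigma
      dsigma_grad (action F t0) (action F t1) (action_grad g t0) (action_grad g t1)
      A0_grad A1_grad x0 eps (ltW eps0) grad_close
      (fun y => hopf H sigma (t1, y)) phi_value phi_diff theta c theta01 prop).
(* Times near [t0] stay in [0, T], where [hopf] is the maximum built on the extension [F]. *)
have near_t0 : \forall t \near t0, 0 < t < T.
  near=> t; apply/andP; split; near: t; [exact: lt_nbhsr|exact: lt_nbhsl].
apply: (value_differentiable L_ge0 sigma_lip (action F) (fun q => F (t0, q)) _ _ _ D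
  D_ge0 _ _ _ _ uniq).
- exact: continuous_action.
- have near_z : \forall z \near (t0, x0), 0 < z.1 < T.
    exact: (@cvg_fst _ _ (nbhs t0) (nbhs x0) _ _ near_t0).
  apply: filterS near_z => -[t x] /= /andP[t_gt0 tT].
  by apply: value; rewrite !ltW.
- apply: filterS near_t0 => t /andP[t_gt0 tT] q qL.
  by apply: action_lip => //; rewrite !ltW.
- by move=> q0 e e0; exact: action_expansion_time.
Unshelve. all: by end_near. Qed.
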